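(* Let $\rho$ be a real-valued invariant of rooted trees satisfying $\rho([T_1,\dots,T_k])=f_\rho(\rho(T_1),\dots,\rho(T_k))$ for a symmetric function $f_\rho$, let $I$ be a maximum-$\rho$-compatible tree invariant, and let $B$ be the degree sequence of a tree. Let $\mathbb T_{\triangleleft B}$ be the set of all trees whose degree sequence is majorised by $B$. (i) If $f_\rho$ is strictly increasing (strictly increasing in each single variable and under addition of further variables) and $\rho(\bullet)<\rho(S)$ for every rooted tree $S$ with more than one vertex, then $\max\{I(T):T\in\mathbb T_{\triangleleft B}\}=I(\mathcal G(B))$. (ii) If $f_\rho$ is strictly decreasing (strictly decreasing in each single variable and under addition of further variables) and $\rho(\bullet)>\rho(S)$ for every rooted tree $S$ with more than one vertex, then $\max\{I(T):T\in\mathbb T_{\triangleleft B}\}=I(\mathcal M(B))$.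
   Context: All trees are finite. $\bullet$ denotes the rooted tree with a single vertex. For rooted trees $T_1,\dots,T_k$, $[T_1,\dots,T_k]$ is the rooted tree whose root is adjacent to exactly the roots of $T_1,\dots,T_k$ (for $k=0$ it is $\bullet$). $f_\rho$ is defined on finite tuples (of any length) of values of $\rho$; ''increasing under addition of further variables'' means that appending additional arguments increases its value (similarly for decreasing). For a tree $H$ with distinct leaves $v,w$, $[L_1,\dots,L_k]vHw[R_1,\dots,R_\ell]$ is the tree obtained by identifying the root of $[L_1,\dots,L_k]$ with $v$ and the root of $[R_1,\dots,R_\ell]$ with $w$. Degree sequences are written in non-increasing order. A sequence $(a_1,\dots,a_n)$ majorises $(b_1,\dots,b_n)$ if $\sum_{i=1}^n a_i=\sum_{i=1}^n b_i$ and $a_1+\cdots+a_k\ge b_1+\cdots+b_k$ for all $1\le k<n$. A (real-valued, isomorphism-invariant) tree invariant $I$ is maximum-$\rho$-compatible if for every tree $H$ and any two distinct leaves $v,w$ of $H$, every collection of rooted trees $T_1,\dots,T_r$ with $\rho(T_1)\ge\cdots\ge\rho(T_r)$, and every integer $s$ with $r/2\le s\le r$, the maximum of $I$ over the set $\mathbb K_s=\{[T_{\sigma(1)},\dots,T_{\sigma(k)}]vHw[T_{\sigma(k+1)},\dots,T_{\sigma(r)}]:\sigma\text{ a permutation of }\{1,\dots,r\},\ r-s\le k\le s\}$ is attained by at least one of the two trees $[T_1,\dots,T_s]vHw[T_{s+1},\dots,T_r]$ and $[T_{s+1},\dots,T_r]vHw[T_1,\dots,T_s]$. Greedy tree $\mathcal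 G(D)$: start with a root $v$ that is assigned the largest degree in $D$. Give $v$ its neighbours $v_1,\dots,v_{d(v)}$ and assign to them the largest available degrees with $d(v_1)\ge d(v_2)\ge\cdots$. Then give $v_1$ its remaining neighbours and assign to them the largest available degrees in non-increasing order; then do the same for $v_2$, $v_3$, etc. Continue in this way, always continuing with the labelled vertex of largest degree whose neighbours are not yet labelled (equivalently, process vertices in breadth-first order, in the order in which they were labelled, always assigning the largest remaining degrees). $\mathcal M$-tree $\mathcal M(D)$: the reduced degree sequence of a tree is the sequence $(d_1,\dots,d_t)$, $d_1\ge\cdots\ge d_t\ge2$, of degrees of non-leaf vertices; it determines the degree sequence (when $t\ge1$), and one writes $\mathcal M(d_1,\dots,d_t)=\mathcal M(D)$. Write $[d]$ for the rooted star with $d$ vertices: a root with $d-1$ leaf children ($[1]=\bullet$). - If $t\le d_t+1$: $\mathcal M(d_1,\dots,d_t)$ is obtained from a star with centre of degree $d_t$ by identifying $t-1$ of its leaves with the roots of $[d_1],\dots,[d_{t-1}]$ respectively. Label the centre $v_1$ and the other non-leaf vertices $v_2,\dots,v_t$ such that $d(v_i)\le d(v_j)$ whenever $i<j$. - If $t\ge d_t+2$: construct first $\mathcal M(d_{d_t},d_{d_t+1},\dots,d_{t-1})$ with its labelling. Let $\ell$ be the largest integer such that $v_\ell$ is a label in it, and $s$ the smallest integer such that $v_s$ is adjacent to a leaf in it. Let $R_{d_t}=[[d_1],\dots,[d_{d_t-1}]]$, and label the roots of $[d_1],\dots,[d_{d_t-1}]$ as $v_{\ell+1},\dots,v_{\ell+d_t-1}$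 so that still $d(v_i)\le d(v_j)$ for $i<j$ (the root of $R_{d_t}$ gets no label). $\mathcal M(d_1,\dots,d_t)$ is obtained by identifying the root of $R_{d_t}$ with a leaf adjacent to $v_s$. If $t=0$ (at most two vertices), $\mathcal M(D)$ is the unique tree with degree sequence $D$. *)

(* Defs.v *)
From mathcomp Require Import all_boot all_order all_fingroup all_algebra.
From mathcomp Require Import mathcomp_extra boolp classical_sets reals.
Set Implicit Arguments.
Unset Strict Implicit.
Unset Printing Implicit Defensive.
Import Order.TTheory GRing.Theory Num.Theory.

(** ** Trees *)

Record tree := Tree {
  vertex :> finType;
  adj : rel vertex;
  adj_sym : symmetric adj;
  adj_irrefl : irreflexive adj;
  tree_nonempty : 0 < #|vertex|;
  tree_connected : forall x y, connect adj x y;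
  (* a two-element [ucycle] is an edge traversed back and forth *)
  tree_acyclic : forall c : seq vertex, ucycle adj c -> size c <= 2 }.

Definition isomorphic (G H : tree) : Prop :=
  exists2 f : G -> H, bijective f & forall x y, adj (f x) (f y) = adj x y.

Definition tree_invariant (A : Type) (I : tree -> A) : Prop :=
  forall G H, isomorphic G H -> I G = I H.

Definition deg (T : tree) (x : T) : nat := #|[pred y | adj x y]|.

Definition leaf (T : tree) (x : T) : bool := deg x == 1.

Definition degree_seq (T : tree) : seq nat :=
  sort geq [seq deg x | x <- enum T].

Definition majorises (a b : seq nat) : Prop :=
  [/\ size a = size b, sumn a = sumn b &
      forall k, 1 <= k < size a -> sumn (take k b) <= sumn (take k a)].

Definition majorised_trees (B : seq nat) (T : tree) : Prop :=
  majorises B (degree_seq T).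

(** ** Rooted trees *)

(* [Node [:: T1; ...; Tk]] is [T1, ..., Tk].  The order of the branches is an
   artefact of the encoding; every quantity computed from rooted trees below is
   insensitive to it. *)
Inductive rtree := Node of seq rtree.

Definition children (T : rtree) : seq rtree := let: Node ts := T in ts.

Definition bullet : rtree := Node [::].

(* A vertex of a rooted tree is addressed by the path of child indices leading
   to it from the root [::]. *)
Fixpoint addresses (T : rtree) : seq (seq nat) :=
  let: Node ts := T in
  let As := [seq addresses t | t <- ts] in
  [::] :: [seq i :: p | i <- iota 0 (size As), p <- nth [::] As i].

Definition child_of (q p : seq nat) : bool :=
  (q != [::]) && (take (size q).-1 q == p).

Lemma nil_addresses T : [::] \in addresses T.
Proof. by case: T => ts; rewrite inE. Qed.

Lemma cons_addresses T i p : (i :: p \in addresses T) =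
  (i < size (children T)) && (p \in addresses (nth bullet (children T) i)).
Proof.
case: T => ts /=; rewrite inE /=; apply/allpairsPdep/andP.
  move=> [j [q []]]; rewrite mem_iota size_map add0n => /= lt_j q_in [-> ->].
  by rewrite (nth_map bullet) in q_in.
move=> [lt_i p_in]; exists i, p; rewrite mem_iota size_map add0n; split=> //.
by rewrite (nth_map bullet).
Qed.

Lemma take_addresses T p n : p \in addresses T -> take n p \in addresses T.
Proof.
elim: p T n => [|i p IHp] T [|n] //; rewrite ?take0 ?nil_addresses //=.
by rewrite !cons_addresses => /andP[-> /IHp->].
Qed.

Lemma child_of_size q p : child_of q p -> size q = (size p).+1.
Proof. by case: q => // i q /andP[_ /eqP<-]; rewrite size_takel. Qed.

(* Key step of acyclicity for the graphs built below: if every vertex of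
   positive rank has at most one neighbour of no larger rank, then every cycle
   stays at rank 0. *)
Lemma ucycle_rank0 (V : finType) (e : rel V) (rk : V -> nat) :
  (forall x y z, 0 < rk x -> rk y <= rk x -> rk z <= rk x ->
     e x y -> e z x -> y = z) ->
  forall c, ucycle e c -> 2 < size c -> {in c, forall x, rk x = 0}.
Proof.
move=> rkP c cyc_c lt2c x x_c.
have [m m_c max_m]: exists2 m, m \in c & {in c, forall y, rk y <= rk m}.
  case: (arg_maxnP rk (P := [in c]) x_c) => m m_c max_m.
  by exists m => // y /max_m.
have le_xm := max_m x x_c.
case: (posnP (rk m)) => [m0|m_gt0]; first by apply/eqP; rewrite -leqn0 -m0.
case: (rot_to m_c) => i s def_s.
have cyc_s: ucycle e (m :: s) by rewrite -def_s rot_ucycle.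
have max_s y : y \in s -> rk y <= rk m.
  by move=> y_s; apply: max_m; rewrite -(mem_rot i) def_s inE y_s orbT.
have: 2 < size (m :: s) by rewrite -def_s size_rot.
case: s => [|y [|z s]] // in def_s cyc_s max_s * => _.
case/andP: cyc_s => /=; rewrite rcons_path => /and3P[e_my _ /andP[_ e_lm]].
case/and3P=> _ /negP[]; have l_in: last z s \in z :: s by apply: mem_last.
by rewrite (rkP m y (last z s)) ?max_s ?mem_head // inE l_in orbT.
Qed.

Section Unroot.
Variable T : rtree.

Let V : finType := seq_sub (addresses T).
Let e : rel V := fun p q =>
  child_of (ssval q) (ssval p) || child_of (ssval p) (ssval q).

Fact unroot_sym : symmetric e.
Proof. by move=> p q; rewrite /e orbC. Qed.

Fact unroot_irrefl : irreflexive e.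
Proof.
by move=> p; apply/negP; rewrite /e orbb => /child_of_size/n_Sn.
Qed.

Fact unroot_nonempty : 0 < #|V|.
Proof. by apply/card_gt0P; exists (SeqSub (nil_addresses T)). Qed.

Fact unroot_connected x y : connect e x y.
Proof.
pose r : V := SeqSub (nil_addresses T).
have conn_r z : connect e r z.
  case: z => p; elim/last_ind: p => [|p i IHp] p_in.
    by rewrite (_ : r = SeqSub p_in) //; apply: val_inj.
  have p_in' : p \in addresses T.
    by rewrite -(take_size_cat [:: i] (erefl (size p))) take_addresses ?cats1.
  apply: connect_trans (IHp p_in') _; apply: connect1.
  rewrite /e /child_of /= size_rcons -cats1 take_size_cat //= eqxx.
  by case: (p).
by rewrite (connect_trans _ (conn_r y)) // (sym_connect_sym unroot_sym).
Qed.

Fact unroot_acyclic (c : seq V) : ucycle e c -> size c <= 2.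
Proof.
move=> cyc_c; rewrite leqNgt; apply/negP => lt2c.
have up (p q : V) : size (ssval q) <= size (ssval p) -> e p q ->
    take (size (ssval p)).-1 (ssval p) = ssval q.
  move=> le_qp /orP[/child_of_size E|/andP[_ /eqP]//].
  by rewrite E ltnn in le_qp.
have all0 : {in c, forall p, size (ssval p) = 0}.
  apply: (@ucycle_rank0 V e (fun p => size (ssval p)) _ c cyc_c lt2c) => p q s _ le_q le_s e_pq.
  rewrite unroot_sym => e_ps.
  by apply: val_inj; rewrite /= -(up p q) // (up p s).
case: c => [|p [|q c]] // in cyc_c lt2c all0 *.
case/andP: cyc_c => _ /= /andP[]; rewrite inE negb_or => /andP[/eqP[]].
apply: val_inj; rewrite /= (size0nil (all0 p _)) ?mem_head //.
by rewrite (size0nil (all0 q _)) // !inE eqxx orbT.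
Qed.

Definition unroot : tree := @Tree V e unroot_sym unroot_irrefl
  unroot_nonempty unroot_connected unroot_acyclic.

End Unroot.

(** ** Identifying the root of a rooted tree with a vertex of a tree *)

Section Attach.
Variables (H : tree) (v : H) (T : rtree).

(* The vertices of H together with the non-root vertices of T. *)
Let V : finType := (H + seq_sub (behead (addresses T)))%type.
Let e : rel V := fun x y =>
  match x, y with
  | inl a, inl b => adj a b
  | inl a, inr q => (a == v) && (size (ssval q) == 1)
  | inr p, inl b => (b == v) && (size (ssval p) == 1)
  | inr p, inr q =>
      child_of (ssval q) (ssval p) || child_of (ssval p) (ssval q)
  end.

Lemma behead_addressesE p :
  (p \in behead (addresses T)) = (p != [::]) && (p \in addresses T).
Proof.
case: T => ts; rewrite [addresses _]/= inE; case: eqP => //= ->.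
by apply/allpairsPdep => -[i [q []]].
Qed.

Fact attach_sym : symmetric e.
Proof.
by move=> [a|p] [b|q] //=; [apply: adj_sym | rewrite orbC].
Qed.

Fact attach_irrefl : irreflexive e.
Proof.
case=> [a|p] /=; first exact: adj_irrefl.
by apply/negP; rewrite orbb => /child_of_size/n_Sn.
Qed.

Fact attach_nonempty : 0 < #|V|.
Proof. by apply/card_gt0P; exists (inl v). Qed.

Fact attach_connected x y : connect e x y.
Proof.
have conn_v z : connect e (inl v) z.
  case: z => [a|[p]].
    have /connectP[s] := tree_connected v a.
    elim: s v => [|b s IHs] u /=; first by move=> _ ->; apply: connect0.
    move=> /andP[e_ub /IHs{}IHs /IHs]; apply: connect_trans.
    exact: (@connect1 _ e (inl u) (inl b)).
  elim/last_ind: p => [|p i IHp] p_in.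
    by have := p_in; rewrite {1}behead_addressesE.
  case: (eqVneq p [::]) => [p0|p_n0].
    by apply: connect1; rewrite /= p0 !eqxx.
  have p_in' : p \in behead (addresses T).
    move: p_in; rewrite !behead_addressesE p_n0 => /andP[_ p_in].
    by rewrite -(take_size_cat [:: i] (erefl (size p))) take_addresses ?cats1.
  apply: connect_trans (IHp p_in') _; apply: connect1.
  rewrite /= /child_of /= size_rcons -cats1 take_size_cat //= eqxx.
  by case: (p).
by rewrite (connect_trans _ (conn_v y)) // (sym_connect_sym attach_sym).
Qed.

Fact attach_acyclic (c : seq V) : ucycle e c -> size c <= 2.
Proof.
move=> cyc_c; rewrite leqNgt; apply/negP => lt2c.
pose rk (x : V) := if x is inr p then size (ssval p) else 0.
have rk_gt0 p : 0 < rk (inr p).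
  by have := ssvalP p; rewrite behead_addressesE /=; case: (ssval p).
pose up (p : seq nat) := take (size p).-1 p.
have upP p (x : V) : rk x <= rk (inr p) -> e (inr p) x ->
    match x with
    | inl b => b = v /\ up (ssval p) = [::]
    | inr q => up (ssval p) = ssval q
    end.
  case: x => [b|q] /=.
    by move=> _ /andP[/eqP-> /eqP p1]; split=> //; rewrite /up p1 take0.
  move=> le_qp /orP[/child_of_size E|/andP[_ /eqP]//].
  by rewrite E ltnn in le_qp.
have nil_out (q : seq_sub (behead (addresses T))) : ssval q <> [::].
  by move=> q0; have := rk_gt0 q; rewrite /= q0.
have all0 : {in c, forall x, rk x = 0}.
  apply: (@ucycle_rank0 V e rk _ c cyc_c lt2c) => -[a|p] // x y _ le_x le_y e_px.
  rewrite attach_sym => e_py.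
  move: (upP _ _ le_x e_px) (upP _ _ le_y e_py) => {le_x le_y e_px e_py}.
  case: x y => [a|q] [b|r].
  - by move=> [-> _] [-> _].
  - by move=> [_ ->] /esym/nil_out.
  - by move=> -> [_ /nil_out].
  - by move=> -> /val_inj->.
have [c0 def_c] : exists c0, c = [seq inl a | a <- c0].
  elim: c all0 {cyc_c lt2c} => [|x c IHc] all0; first by exists [::].
  have [|c0 ->] := IHc; first by move=> y y_c; rewrite all0 // inE y_c orbT.
  have := all0 x (mem_head _ _); case: x all0 => [a|p] _ x0.
    by exists (a :: c0).
  by have := rk_gt0 p; rewrite x0.
move: cyc_c lt2c; rewrite def_c size_map /ucycle => /andP[cyc_c].
rewrite map_inj_uniq => [uniq_c|a b []//]; rewrite ltnNge tree_acyclic //.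
by rewrite /ucycle uniq_c andbT; move: cyc_c; rewrite cycle_map.
Qed.

Definition attach : tree := @Tree V e attach_sym attach_irrefl
  attach_nonempty attach_connected attach_acyclic.

End Attach.

(* [L1, ..., Lk] v H w [R1, ..., Rl] *)
Definition join (H : tree) (v w : H) (Ls Rs : seq rtree) : tree :=
  @attach (attach v (Node Ls)) (inl w) (Node Rs).

(** ** Invariants of rooted trees and compatibility *)

Section Compatibility.
Local Open Scope ring_scope.
Local Open Scope classical_set_scope.
Context {R : realType}.
Implicit Types (rho : rtree -> R) (f : seq R -> R) (xs ys : seq R).

(* [set tree] would be universe-inconsistent, hence the plain predicate P. *)
Definition values_on (P : tree -> Prop) (I : tree -> R) : set R :=
  [set y | exists2 T : tree, P T & I T = y].

Definition is_max (A : set R) (m : R) : Prop := A m /\ ubound A m.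

Definition rho_values rho xs : Prop := exists ts, xs = [seq rho t | t <- ts].

(* f is only meaningful on tuples of values of rho. *)
Definition symmetric_on rho f : Prop :=
  forall xs ys, rho_values rho xs -> perm_eq xs ys -> f xs = f ys.

Definition strictly_increasing_on rho f : Prop :=
  (forall xs x y ys, rho_values rho (xs ++ x :: ys) ->
     rho_values rho (xs ++ y :: ys) ->
     x < y -> f (xs ++ x :: ys) < f (xs ++ y :: ys)) /\
  (forall xs ys, rho_values rho (xs ++ ys) -> ys <> [::] ->
     f xs < f (xs ++ ys)).

Definition strictly_decreasing_on rho f : Prop :=
  (forall xs x y ys, rho_values rho (xs ++ x :: ys) ->
     rho_values rho (xs ++ y :: ys) ->
     x < y -> f (xs ++ y :: ys) < f (xs ++ x :: ys)) /\
  (forall xs ys, rho_values rho (xs ++ ys) -> ys <> [::] ->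
     f (xs ++ ys) < f xs).

Definition arrangements (H : tree) (v w : H) (r : nat) (ts : r.-tuple rtree)
    (s : nat) (K : tree) : Prop :=
  exists sigma : 'S_r, exists2 k : nat, (r - s <= k <= s)%N &
    let us := [seq tnth ts (sigma i) | i <- enum 'I_r] in
    K = join v w (take k us) (drop k us).

Definition max_compatible rho (I : tree -> R) : Prop :=
  forall (H : tree) (v w : H), leaf v -> leaf w -> v != w ->
  forall (r : nat) (ts : r.-tuple rtree) (s : nat),
    sorted >=%R [seq rho t | t <- ts] -> (r <= s.*2)%N -> (s <= r)%N ->
    is_max (values_on (arrangements v w ts s) I)
           (I (join v w (take s ts) (drop s ts))) \/
    is_max (values_on (arrangements v w ts s) I)
           (I (join v w (drop s ts) (take s ts))).

End Compatibility.

(** ** Greedy trees and M-trees *)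

Fixpoint subtree_at (T : rtree) (p : seq nat) : rtree :=
  if p is i :: q then subtree_at (nth bullet (children T) i) q else T.

(* When p is the address of a leaf this identifies the root of S with it. *)
Fixpoint replace_at (T : rtree) (p : seq nat) (S : rtree) : rtree :=
  if p is i :: q then
    Node (set_nth bullet (children T) i
            (replace_at (nth bullet (children T) i) q S))
  else S.

(* [queue] holds the addresses of the vertices whose neighbours are not yet
   labelled, in the order in which they were labelled, and [ds] begins with
   their degrees: as degrees are handed out in the order of labelling, the i-th
   labelled vertex has the i-th largest degree, so the head of [queue] always
   has the largest degree. *)
Fixpoint grow (T : rtree) (queue : seq (seq nat)) (ds : seq nat) : rtree :=
  match queue, ds with
  | p :: queue', d :: ds' =>
      let c := if p == [::] then d else d.-1 in
      grow (replace_at T p (Node (nseq c bullet)))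
           (queue' ++ [seq rcons p i | i <- iota 0 c]) ds'
  | _, _ => T
  end.

Definition greedy_tree (D : seq nat) : tree :=
  unroot (grow bullet [:: [::]] D).

(* The rooted star [d]. *)
Definition star (d : nat) : rtree := Node (nseq d.-1 bullet).

(* The pair (M(d_1, ..., d_t), [:: v_1; v_2; ...]): the tree is rooted at v_1
   and the labelled vertices are given by their addresses.  Since every label is
   on a non-leaf vertex whose parent, if any, is not a leaf, the leaves adjacent
   to a labelled vertex are its children without children.  Labels on vertices
   of equal degree among the roots of [d_i]'s attached together may be exchanged
   by an automorphism, so fixing their order loses nothing.  The first argument
   is fuel: each recursive call drops d_t >= 2 entries. *)
Fixpoint Mtree_rec (fuel : nat) (ds : seq nat) : rtree * seq (seq nat) :=
  let t := size ds in
  let d := last 0 ds in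
  let base :=
    (Node ([seq star e | e <- rev (take t.-1 ds)] ++ nseq (d - t.-1) bullet),
     [::] :: [seq [:: i] | i <- iota 0 t.-1]) in
  if fuel isn't fuel'.+1 then base else
  if t <= d.+1 then base else
  let: (T, labels) := Mtree_rec fuel' (drop d.-1 (take t.-1 ds)) in
  let is_leaf S := nilp (children S) in
  let vs :=
    nth [::] labels
      (find (fun p => has is_leaf (children (subtree_at T p))) labels) in
  let i0 := find is_leaf (children (subtree_at T vs)) in
  let Rd := Node [seq star e | e <- rev (take d.-1 ds)] in
  (replace_at T (rcons vs i0) Rd,
   labels ++ [seq vs ++ [:: i0; i] | i <- iota 0 d.-1]).

Definition reduced (D : seq nat) : seq nat := [seq d <- D | 2 <= d].

(* With empty reduced degree sequence, D is (0) or (1,1). *)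
Definition Mtree (D : seq nat) : tree :=
  let ds := reduced D in
  unroot (if ds is [::] then Node (nseq (size D).-1 bullet)
          else (Mtree_rec (size ds) ds).1).

(* Main.v *)
(* Trees are contracted from the leaves as in Huffman's algorithm.  Suppose that
   the branches in A are just enough to fill up a vertex of degree d, where either
   d is the least remaining degree and A has the smallest values of rho, or d is
   the greatest remaining degree and A has the largest values.  An exchange between
   a vertex of degree d and any other vertex leaves, at one of the two ends, a
   vertex of degree d that carries the branches of A from both ends.  So finitely
   many exchanges, none of which decreases I, gather A at a single vertex of degree
   d, which then counts as a leaf.  It does not matter which of the two trees in the
   definition of compatibility attains the maximum, and equal values of rho are
   harmless because the branches to be gathered are fixed beforehand.

   If f_rho increases, one gathers the smallest branches at a vertex of least degree
   in every step, and this builds the greedy tree in reverse breadth-first order.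
   If f_rho decreases, one gathers the largest branches at a vertex of greatest
   degree, forming stars of small rho, until the stars are enough to fill up a
   vertex of least degree; this unwinds the recursion for the M-tree.

   Majorisation reduces to unit transfers between two degrees, and a unit transfer
   is an exchange in which s exceeds the larger number of branches by one. *)

From HB Require Import structures.
Require Import Defs.
From mathcomp Require Import all_boot all_order all_fingroup all_algebra.
From mathcomp Require Import zify.
From mathcomp Require Import mathcomp_extra boolp classical_sets reals.
Set Implicit Arguments.
Unset Strict Implicit.
Unset Printing Implicit Defensive.
Import Order.TTheory GRing.Theory Num.Theory.

(** An exchange has to send the branches of [A] ahead of everything they compete with, including
    branches whose interior is unknown. This requires a bound on [rho] for every branch that could
    be assembled from the current leaves and the remaining degrees. Since the degrees are used up in
    monotone order, each vertex of such a branch compares in size with the last bundle, and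
    monotonicity carries a comparison of the children over to the vertex. Hence the invariants
    remember the children of the last bundle; in the decreasing case, those of the last star and of
    the last bundle of stars.

    The handshake lemma fixes the number of leaves at every stage, so there are always enough of
    them for the next bundle. A vertex of degree one is a bundle of no branches, which lets the
    contraction start from a tree with nothing hidden.

    Compatibility speaks of two leaves of a tree [H]. Rerooting turns any two vertices of a tree
    into the root and the far end of a chain of first children, and all exchanges are carried out
    there. *)

HB.instance Definition _ := gen_eqMixin rtree.

Lemma rtree_nested_ind (P : rtree -> Prop) :
  (forall ts, (forall t, t \in ts -> P t) -> P (Node ts)) -> forall t, P t.
Proof.
move=> IH; fix loop 1 => -[ts]; apply: IH.
(* [loop] is cleared so that closing the goal cannot use it on an unguarded argument. *)
elim: ts => [|t ts IHts] u; first by clear loop; rewrite in_nil.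
by rewrite inE => /orP[/eqP->|/IHts].
Qed.

(** * Isomorphisms *)

Lemma isomorphic_trans G H K :
  isomorphic G H -> isomorphic H K -> isomorphic G K.
Proof.
move=> [f f_bij fE] [g g_bij gE]; exists (g \o f); first exact: bij_comp.
by move=> x y /=; rewrite gE fE.
Qed.

(* An additional edge between the images of two non-adjacent vertices would close
   a cycle. *)
Lemma bijective_hom_isomorphic (G H : tree) (f : G -> H) :
  bijective f -> (forall x y, adj x y -> adj (f x) (f y)) -> isomorphic G H.
Proof.
move=> f_bij fP; exists f => // x y; apply/idP/idP; last exact: fP.
move=> fxy; have /connectP[p0 p0P yE] := tree_connected x y.
have f_inj := bij_inj f_bij.
move: yE; case/shortenP: p0P => p pP p_uniq _ {p0} yE.
have /tree_acyclic : ucycle (@adj H) (map f (x :: p)).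
  rewrite /ucycle (map_inj_uniq f_inj) p_uniq andbT /= rcons_path last_map -yE.
  by rewrite adj_sym fxy andbT (homo_path (e := @adj G)).
case: p pP p_uniq yE => [|z [|//]] /=; last by rewrite andbT => + _ ->.
by move=> _ _ yE; move: fxy; rewrite yE adj_irrefl.
Qed.

Lemma attach_isomorphic (G H : tree) (f : G -> H) (v : G) (T : rtree) :
  bijective f -> (forall x y, adj (f x) (f y) = adj x y) ->
  isomorphic (attach v T) (attach (f v) T).
Proof.
move=> f_bij fE; have f_inj := bij_inj f_bij; case: (f_bij) => g fK gK.
pose h (x : attach v T) : attach (f v) T :=
  match x with inl a => inl (f a) | inr q => inr q end.
pose h' (x : attach (f v) T) : attach v T :=
  match x with inl a => inl (g a) | inr q => inr q end.
exists h; first by exists h' => -[a|q] //=; rewrite ?fK ?gK.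
by move=> [a|p] [b|q] //=; rewrite ?(inj_eq f_inj).
Qed.

Lemma child_ofP q p : reflect (exists i, q = rcons p i) (child_of q p).
Proof.
apply: (iffP idP) => [|[i ->]]; last first.
  rewrite /child_of -cats1 size_cat addn1 take_size_cat //= eqxx andbT.
  by case: (p).
rewrite /child_of; case/lastP: q => // q i /andP[_].
by rewrite size_rcons -cats1 take_size_cat // => /eqP->; exists i; rewrite cats1.
Qed.

Lemma child_of_rcons p i : child_of (rcons p i) p.
Proof. by apply/child_ofP; exists i. Qed.

Lemma child_of_cons i p q : child_of (i :: q) (i :: p) = child_of q p.
Proof.
apply/child_ofP/child_ofP => -[j E]; exists j; first by case: E.
by rewrite E.
Qed.

Lemma child_of_cat r p q : child_of (r ++ q) (r ++ p) = child_of q p.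
Proof. by elim: r => //= i r IH; rewrite child_of_cons. Qed.

Lemma child_of_nil q : child_of q [::] = (size q == 1).
Proof. by case: q => [|i [|j q]]. Qed.

(** The disjunction allows an edge to change direction, as happens when the root moves. Preserving
    edges one way is enough because both graphs are trees. *)
Lemma unroot_isomorphic (t u : rtree) (f g : seq nat -> seq nat) :
  {in addresses t, forall p, f p \in addresses u} ->
  {in addresses u, forall p, g p \in addresses t} ->
  {in addresses t, cancel f g} -> {in addresses u, cancel g f} ->
  (forall p i, rcons p i \in addresses t ->
     child_of (f (rcons p i)) (f p) || child_of (f p) (f (rcons p i))) ->
  isomorphic (unroot t) (unroot u).
Proof.
move=> f_in g_in fK gK f_adj.
pose F (x : unroot t) : unroot u := SeqSub (f_in _ (ssvalP x)).
pose G (x : unroot u) : unroot t := SeqSub (g_in _ (ssvalP x)).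
apply: (@bijective_hom_isomorphic _ _ F).
  by exists G => -[p p_in]; apply: val_inj; rewrite /= ?fK ?gK.
move=> [p p_in] [q q_in] /= /orP[] /child_ofP[i E].
  by rewrite E in q_in *; apply: f_adj.
by rewrite E in p_in *; rewrite orbC; apply: f_adj.
Qed.

Lemma unroot_perm ts us :
  perm_eq ts us -> isomorphic (unroot (Node ts)) (unroot (Node us)).
Proof.
move=> eq_tu; have size_tu := perm_size eq_tu.
have /(perm_iotaP bullet)[Is IsP tsE] := eq_tu.
have size_Is : size Is = size us by rewrite (perm_size IsP) size_iota.
have Is_uniq : uniq Is by rewrite (perm_uniq IsP) iota_uniq.
have memIs i : (i \in Is) = (i < size us).
  by rewrite (perm_mem IsP) mem_iota add0n.
pose f p := if p is i :: q then nth 0 Is i :: q else [::].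
pose g p := if p is i :: q then index i Is :: q else [::].
apply: (@unroot_isomorphic _ _ f g).
- case=> [|i p]; first by rewrite !nil_addresses.
  rewrite !cons_addresses /= => /andP[i_lt p_in].
  rewrite -memIs mem_nth ?size_Is -?size_tu //=.
  by move: p_in; rewrite {1}tsE (nth_map 0) // size_Is -size_tu.
- case=> [|i p]; first by rewrite !nil_addresses.
  rewrite !cons_addresses /= => /andP[i_lt p_in].
  have i_in : i \in Is by rewrite memIs.
  rewrite size_tu -size_Is index_mem i_in /= tsE (nth_map 0) ?index_mem //.
  by rewrite nth_index.
- case=> [|i p] //; rewrite cons_addresses /= => /andP[i_lt _].
  by rewrite index_uniq // size_Is -size_tu.
- case=> [|i p] //; rewrite cons_addresses /= => /andP[i_lt _].
  by rewrite nth_index // memIs.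
- by case=> [|j p] i _ //=; rewrite !child_of_cons child_of_rcons.
Qed.

(** The root moves across its first edge, so the addresses [[::]] and [[:: 0]] trade places.
    Together with [unroot_perm] this generates every rerooting. *)
Lemma unroot_reroot ts us :
  isomorphic (unroot (Node (Node ts :: us))) (unroot (Node (Node us :: ts))).
Proof.
pose f p := match p with
  | [::] => [:: 0] | [:: 0] => [::]
  | 0 :: i :: q => i.+1 :: q | i.+1 :: q => 0 :: i :: q end.
have f_in ts' us' : {in addresses (Node (Node ts' :: us')),
    forall p, f p \in addresses (Node (Node us' :: ts'))}.
  by case=> [|[|i] [|j q]]; rewrite /f !(cons_addresses, nil_addresses).
have fK ts' us' : {in addresses (Node (Node ts' :: us')), cancel f f}.
  by case=> [|[|i] [|j q]].
apply: (@unroot_isomorphic _ _ f f) => //.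
case=> [|[|j] p] i _ /=.
- by case: i => [|i] /=; rewrite ?child_of_cons ?child_of_nil ?orbT.
- case: p => [|k p] //=.
  by rewrite child_of_cons child_of_rcons.
- by rewrite !child_of_cons child_of_rcons.
Qed.

(** * Grafting *)

Lemma addresses_nth ts i p :
  (i :: p \in addresses (Node ts)) =
  (i < size ts) && (p \in addresses (nth bullet ts i)).
Proof. exact: cons_addresses. Qed.

Lemma subtree_at_cat t p q : subtree_at t (p ++ q) = subtree_at (subtree_at t p) q.
Proof. by elim: p t => //= i p IH t. Qed.

Lemma mem_addresses_cat t p q : p \in addresses t ->
  (p ++ q \in addresses t) = (q \in addresses (subtree_at t p)).
Proof.
elim: p t => //= i p IH t; rewrite !cons_addresses => /andP[-> p_in] /=.
exact: IH.
Qed.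

Lemma rcons_addresses t p i :
  (rcons p i \in addresses t) =
  (p \in addresses t) && (i < size (children (subtree_at t p))).
Proof.
elim: p t => [|j p IH] t /=.
  by rewrite cons_addresses !nil_addresses andbT.
by rewrite !cons_addresses IH andbA.
Qed.

Lemma addresses_replace_at t p S q : p \in addresses t ->
  (q \in addresses (replace_at t p S)) =
  if prefix p q then drop (size p) q \in addresses S else q \in addresses t.
Proof.
elim: p t q => [|i p IH] t q; first by rewrite /= prefix0s drop0.
rewrite cons_addresses => /andP[i_lt p_in].
case: q => [|j q]; first by rewrite !nil_addresses.
rewrite addresses_nth prefix_cons nth_set_nth size_set_nth /= (maxn_idPr i_lt).
rewrite eq_sym cons_addresses; case: eqVneq => [<-|] //=.
by rewrite i_lt IH.
Qed.

(** The new branches come after the existing children, so that old addresses remain valid. *)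
Definition graft t p ts := replace_at t p (Node (children (subtree_at t p) ++ ts)).

Lemma addresses_graft_old t p ts : p \in addresses t ->
  {subset addresses t <= addresses (graft t p ts)}.
Proof.
move=> p_in q q_in; rewrite addresses_replace_at //.
case: prefixP => // -[[|i r] ->{q}] in q_in *; rewrite drop_size_cat //.
rewrite mem_addresses_cat // cons_addresses in q_in.
case/andP: q_in => i_lt r_in.
by rewrite addresses_nth size_cat ltn_addr //= nth_cat i_lt.
Qed.

Lemma addresses_graft_new t p ts i q : p \in addresses t ->
  (p ++ (size (children (subtree_at t p)) + i) :: q \in addresses (graft t p ts))
  = (i :: q \in addresses (Node ts)).
Proof.
move=> p_in; rewrite addresses_replace_at // prefix_prefix drop_size_cat //.
rewrite !addresses_nth size_cat ltn_add2l nth_cat addKn.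
by rewrite [size _ + i < size _]ltnNge leq_addr.
Qed.

Lemma addresses_graftP t p ts q : p \in addresses t ->
  q \in addresses (graft t p ts) ->
  q \in addresses t \/
  exists i r, [/\ q = p ++ (size (children (subtree_at t p)) + i) :: r
                 & i :: r \in addresses (Node ts)].
Proof.
move=> p_in q_in; case: (boolP (q \in addresses t)) => [|q_nin]; first by left.
right; have := q_in; rewrite addresses_replace_at //.
case: prefixP => [[[|i r] qE]|]; last by rewrite (negPf q_nin).
  by move: q_nin; rewrite qE cats0 p_in.
move: q_in q_nin; rewrite {}qE drop_size_cat // => q_in.
rewrite mem_addresses_cat // cons_addresses addresses_nth size_cat nth_cat.
case: ltnP => //= [i_lt|le_i _ _]; first by case: (r \in _) => //; rewrite andbF.
exists (i - size (children (subtree_at t p))), r; rewrite subnKC //; split=> //.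
by rewrite -(subnKC le_i) addresses_graft_new in q_in.
Qed.

Lemma inj_surj_bijective (T U : finType) (f : T -> U) :
  injective f -> (forall y, exists x, f x = y) -> bijective f.
Proof.
move=> f_inj f_surj; apply: inj_card_bij => //.
rewrite -(card_codom f_inj); apply: subset_leq_card; apply/fintype.subsetP => y _.
by have [x <-] := f_surj y; apply: codom_f.
Qed.

(** The last clause keeps track of old vertices: a join attaches twice, and the second attachment
    point must be found again after the first. *)
Lemma attach_graft t p ts (p_in : p \in addresses t) :
  exists f : attach (SeqSub p_in : unroot t) (Node ts) -> unroot (graft t p ts),
    [/\ bijective f, forall x y, adj (f x) (f y) = adj x y
      & forall a : unroot t, ssval (f (inl a)) = ssval a].
Proof.
set k := size (children (subtree_at t p)).
set V := attach _ _.
have newP q : q \in behead (addresses (Node ts)) ->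
    exists i r, q = i :: r /\ i :: r \in addresses (Node ts).
  by rewrite behead_addressesE; case: q => // i r /andP[_]; exists i, r.
pose g (x : V) : seq nat :=
  match x with
  | inl a => ssval a
  | inr q => p ++ (if ssval q is i :: r then (k + i) :: r else [::])
  end.
have g_in x : g x \in addresses (graft t p ts).
  case: x => [[a a_in]|[q q_in]] /=; first exact: addresses_graft_old.
  by have [i [r [-> ir_in]]] := newP q q_in; rewrite addresses_graft_new.
pose f x : unroot (graft t p ts) := SeqSub (g_in x).
(* In [t] the vertex [p] has only [k] children, so old and new addresses never coincide. *)
have old_lt a i r : a \in addresses t -> a = p ++ (k + i) :: r -> False.
  move=> + aE; rewrite aE mem_addresses_cat // cons_addresses.
  by rewrite ltnNge leq_addr.
have f_inj : injective f.
  move=> x y /(congr1 val) /=.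
  case: x => [[a a_in]|[q q_in]]; case: y => [[b b_in]|[s s_in]] /=.
  - by move=> ab; congr inl; apply: val_inj.
  - move=> E; exfalso; move: E; have [j [r [-> _]]] := newP _ s_in.
    by move=> /(old_lt _ _ _ a_in).
  - move=> E; exfalso; move: E; have [j [r [-> _]]] := newP _ q_in.
    by move=> /esym/(old_lt _ _ _ b_in).
  - move=> E; congr inr; apply: val_inj => /=; move: E.
    have [i [r [-> _]]] := newP _ q_in; have [j [r' [-> _]]] := newP _ s_in.
    by move=> /eqP; rewrite eqseq_cat // eqxx => /eqP[/addnI-> ->].
have f_bij : bijective f.
  apply: inj_surj_bijective => // -[q q_in].
  have [a_in|[i [r [qE ir_in]]]] := addresses_graftP p_in q_in.
    by exists (inl (SeqSub a_in)); apply: val_inj.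
  have b_in : i :: r \in behead (addresses (Node ts)) by rewrite behead_addressesE.
  by exists (inr (SeqSub b_in)); apply: val_inj; rewrite /= -qE.
exists f; split=> // x y.
have adj_new (a : unroot t) (q : seq_sub (behead (addresses (Node ts)))) :
    adj (f (inl a)) (f (inr q)) = (a == SeqSub p_in) && (size (ssval q) == 1).
  case: a q => [a a_in] [q q_in] /=.
  have [i [r [-> _]]] := newP q q_in.
  have -> : child_of a (p ++ (k + i) :: r) = false.
    apply/negP => /child_ofP[j aE]; apply: (old_lt a i (rcons r j) a_in).
    by rewrite aE rcons_cat.
  rewrite orbF; apply/child_ofP/andP => [[j]|[/eqP[->] /eqP]].
    case/lastP: r => [|r l].
      by rewrite cats1 => /rcons_inj[ap _]; split=> //; apply/eqP/val_inj.
    rewrite -(rcons_cons (k + i)) -rcons_cat => /rcons_inj[/esym/(old_lt a _ _ a_in)].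
    by [].
  by case: r => // _; exists (k + i); rewrite cats1.
case: x y => [a|q] [b|s] //.
- by rewrite adj_sym adj_new.
- case: q s => [q q_in] [s s_in] /=.
  have [i [r [-> _]]] := newP _ q_in; have [j [r' [-> _]]] := newP _ s_in.
  rewrite !child_of_cat.
  have shift c d u v :
      child_of ((k + c) :: u) ((k + d) :: v) = child_of (c :: u) (d :: v).
    apply/child_ofP/child_ofP => -[l [/eqP]].
      by rewrite eqn_add2l => /eqP-> ->; exists l.
    by move=> /eqP-> ->; exists l.
  by rewrite !shift.
Qed.

(** A context whose hole is reached by always taking the first child; [c] lists the other branches
    at each vertex on the way, the top one first. *)
Definition plug (c : seq (seq rtree)) (T : rtree) : rtree :=
  foldr (fun s a => Node (a :: s)) T c.

(** * Degrees of the vertices of a rooted tree *)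

Lemma deg_unroot (t : rtree) (x : unroot t) :
  deg x = (ssval x != [::]) + size (children (subtree_at t (ssval x))).
Proof.
case: x => p p_in /=; set k := size _.
pose nbrs := nseq (p != [::]) (take (size p).-1 p) ++ mkseq (rcons p) k.
have -> : (p != [::]) + k = size nbrs by rewrite size_cat size_nseq size_mkseq.
rewrite /deg cardE -(size_map val); apply/perm_size/uniq_perm.
- by rewrite (map_inj_uniq val_inj) enum_uniq.
- rewrite cat_uniq mkseq_uniq => [|i j /rcons_inj[]] //; case: (p != [::]) => /=.
    rewrite andbT; apply/hasPn => q /mapP[i _ ->]; rewrite inE.
    apply/negP => /eqP/(congr1 size).
    rewrite size_rcons size_take; case: ifP => [_ E|_ /esym/n_Sn]//.
    by have := leq_pred (size p); rewrite -E ltnn.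
  by rewrite andbT; apply/hasPn.
move=> q; rewrite mem_cat mem_nseq lt0b; apply/mapP/orP.
  move=> [[q' q_in]]; rewrite mem_enum inE /= => /orP[] q_adj ->.
    right; have /child_ofP[i qE] := q_adj; apply/mapP; exists i => //.
    by move: q_in; rewrite qE rcons_addresses p_in mem_iota add0n.
  left; have /child_ofP[i pE] := q_adj.
  rewrite pE size_rcons -cats1 take_size_cat // eqxx andbT.
  by case: (q').
case=> [/andP[p_n0 /eqP qE]|/mapP[i]].
  have q_in : q \in addresses t by rewrite qE take_addresses.
  exists (SeqSub q_in) => //.
  by rewrite mem_enum inE /= orbC /child_of p_n0 -qE eqxx.
rewrite mem_iota add0n => i_lt ->.
have q_in : rcons p i \in addresses t by rewrite rcons_addresses p_in.
by exists (SeqSub q_in) => //; rewrite mem_enum inE /= child_of_rcons.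
Qed.

(* The degrees of the vertices of a branch, the root of the branch having one
   further neighbour outside. *)
Fixpoint branch_degs (t : rtree) : seq nat :=
  let: Node ts := t in (size ts).+1 :: flatten (map branch_degs ts).

Definition root_degs (t : rtree) : seq nat :=
  size (children t) :: flatten (map branch_degs (children t)).

Lemma map_addresses (A : Type) (h : seq nat -> A) ts :
  [seq h p | p <- addresses (Node ts)] =
  h [::] :: flatten [seq [seq h (i :: p) | p <- addresses (nth bullet ts i)]
                    | i <- iota 0 (size ts)].
Proof.
rewrite /= size_map; congr cons; rewrite /allpairs_dep map_flatten -!map_comp.
congr flatten; apply/eq_in_map => i; rewrite mem_iota add0n => i_lt /=.
by rewrite (nth_map bullet) // -map_comp.
Qed.

Lemma branch_degsE t :
  [seq (size (children (subtree_at t p))).+1 | p <- addresses t] = branch_degs t.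
Proof.
elim/rtree_nested_ind: t => ts IH; rewrite map_addresses; congr cons.
rewrite -[in RHS](mkseq_nth bullet ts) -map_comp; congr flatten.
apply/eq_in_map => i; rewrite mem_iota add0n => i_lt /=.
by apply: IH; apply: mem_nth.
Qed.

Lemma uniq_addresses t : uniq (addresses t).
Proof.
elim/rtree_nested_ind: t => ts IH; rewrite cons_uniq size_map; apply/andP; split.
  by apply/allpairsPdep => -[i [q []]].
apply: allpairs_uniq_dep; first exact: iota_uniq.
  move=> i; rewrite mem_iota add0n => i_lt.
  by rewrite (nth_map bullet) // IH ?mem_nth.
by move=> [i p] [j q] _ _ /= [-> ->].
Qed.

Lemma perm_degs_unroot t : perm_eq [seq deg x | x <- enum (unroot t)] (root_degs t).
Proof.
pose h p := (p != [::]) + size (children (subtree_at t p)).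
have -> : root_degs t = [seq h p | p <- addresses t].
  case: t @h => ts h; rewrite map_addresses /h; congr cons.
  rewrite -[in LHS](mkseq_nth bullet ts) -map_comp; congr flatten.
  apply/eq_in_map => i; rewrite mem_iota add0n => i_lt.
  by rewrite [LHS]/= -branch_degsE; apply: eq_map => p; rewrite add1n.
have -> : [seq deg x | x <- enum (unroot t)] =
          [seq h p | p <- [seq ssval x | x <- enum (unroot t)]].
  rewrite -[RHS]map_comp; apply: eq_map => x /=.
  by rewrite deg_unroot.
apply/perm_map/uniq_perm; last 1 first.
- move=> p; apply/mapP/idP => [[[q q_in] _ ->] //|p_in].
  by exists (SeqSub p_in); rewrite ?mem_enum.
- by rewrite (map_inj_uniq val_inj) enum_uniq.
- exact: uniq_addresses.
Qed.

Lemma geq_trans : transitive geq.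
Proof. by move=> m n p /= ? /leq_trans->. Qed.

Lemma geq_total : total geq.
Proof. by move=> m n; apply: leq_total. Qed.

Lemma geq_anti : antisymmetric geq.
Proof. by move=> m n /andP[? ?]; apply/anti_leq/andP. Qed.

Lemma sorted_geq_rcons s d :
  sorted geq (rcons s d) -> {in rcons s d, forall e, d <= e}.
Proof.
rewrite (sorted_pairwise geq_trans) -cats1 pairwise_cat => /andP[/allrelP s_ge _] e.
rewrite cats1 mem_rcons inE => /orP[/eqP-> //|e_in].
by apply: s_ge; rewrite ?mem_head.
Qed.

Lemma perm_degree_seq (T : tree) (D : seq nat) :
  perm_eq [seq deg x | x <- enum T] D -> degree_seq T = sort geq D.
Proof.
by move=> /(perm_sortP geq_total geq_trans geq_anti).
Qed.

Lemma degree_seq_unroot t : degree_seq (unroot t) = sort geq (root_degs t).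
Proof. exact/perm_degree_seq/perm_degs_unroot. Qed.

Lemma isomorphic_degree_seq G H : isomorphic G H -> degree_seq G = degree_seq H.
Proof.
case=> f f_bij fE; have f_inj := bij_inj f_bij; apply: perm_degree_seq.
have degE x : deg x = deg (f x).
  rewrite /deg -(card_image f_inj); apply: eq_card => y; rewrite inE.
  have [g fK gK] := f_bij; apply/fintype.imageP/idP => [[z + ->]|xy].
    by rewrite inE fE.
  by exists (g y); rewrite ?gK // inE -fE gK.
have -> : [seq deg x | x <- enum G] = [seq deg y | y <- map f (enum G)].
  by rewrite -map_comp; apply: eq_map.
apply/perm_map/uniq_perm; last 1 first.
- by move=> y; have [g fK gK] := f_bij; rewrite -(gK y) map_f ?mem_enum.
- by rewrite (map_inj_uniq f_inj) enum_uniq.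
- exact: enum_uniq.
Qed.

(** * Every tree is the underlying tree of a rooted tree *)

(** A rooted tree mapped injectively into [T] is enlarged by one vertex at a time. Once the map is
    bijective, it is an isomorphism because both sides are trees. *)
Lemma tree_unroot (T : tree) : exists t, isomorphic (unroot t) T.
Proof.
have /card_gt0P[r _] := tree_nonempty T.
pose embeds n := exists t (f : unroot t -> T),
  [/\ #|unroot t| = n, injective f & forall x y, adj x y -> adj (f x) (f y)].
have embeds1 : embeds 1.
  have sub1 (x y : unroot bullet) : x = y.
    by case: x y => [p p_in] [q q_in]; apply: val_inj; move: p_in q_in;
      rewrite /= !inE => /eqP-> /eqP->.
  exists bullet, (fun=> r); rewrite card_seq_sub //; split=> // x y.
  by rewrite (sub1 x y) adj_irrefl.
suff emb n : 0 < n <= #|T| -> embeds n.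
  have [|t [f [card_t f_inj f_hom]]] := emb #|T|.
    by rewrite leqnn andbT tree_nonempty.
  exists t; apply: (bijective_hom_isomorphic (f := f)) => //.
  by apply: inj_card_bij; rewrite // card_t.
elim: n => // -[_ //|n] IH /andP[_ n_lt].
have [|t [f [card_t f_inj f_hom]]] := IH; first exact: ltnW.
have [y y_out] : exists y, y \notin codom f.
  apply/existsP; rewrite -negb_forall; apply/negP => /forallP codomT.
  have : #|T| <= #|codom f| by apply/subset_leq_card/fintype.subsetP => y _.
  by rewrite card_codom // card_t leqNgt n_lt.
(* The first edge by which a path from the image of the root to [y] leaves the image. *)
have [x [z [z_out xz]]] : exists x z, z \notin codom f /\ adj (f x) z.
  have root_in : SeqSub (nil_addresses t) \in unroot t by [].
  have /connectP[s sP yE] := tree_connected (f (SeqSub (nil_addresses t))) y.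
  elim: s (SeqSub _) sP yE {root_in} => [|a s IHs] b /=.
    by move=> _ yE; move: y_out; rewrite yE codom_f.
  move=> /andP[ba sP] yE; case: (boolP (a \in codom f)) => [|a_out].
    by case/codomP => c aE; apply: (IHs c); rewrite -aE.
  by exists b, a.
case: x xz => p p_in xz.
have [g [[g' gK g'K] g_adj g_old]] := attach_graft [:: bullet] p_in.
pose f' (x : attach (SeqSub p_in : unroot t) (Node [:: bullet])) : T :=
  match x with inl a => f a | inr _ => z end.
have newP (q : seq_sub (behead (addresses (Node [:: bullet])))) : ssval q = [:: 0].
  by have := ssvalP q; rewrite inE => /eqP.
have f'_inj : injective f'.
  move=> [a|q] [b|s] /=.
  - by move/f_inj->.
  - by move=> zE; move: z_out; rewrite -zE codom_f.
  - by move=> zE; move: z_out; rewrite zE codom_f.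
  - by move=> _; congr inr; apply: val_inj; rewrite /= !newP.
exists (graft t p [:: bullet]), (f' \o g'); split.
- rewrite -(bij_eq_card (f := g)); last by exists g'.
  by rewrite card_sum [X in _ + X]card_seq_sub //= addn1 -card_t.
- by apply: inj_comp => //; apply: can_inj g'K.
move=> a b; rewrite -[a]g'K -[b]g'K g_adj /= !gK.
case: (g' a) (g' b) => [c|q] [d|s] /=.
- exact: f_hom.
- by move=> /andP[/eqP-> _].
- by move=> /andP[/eqP-> _]; rewrite adj_sym.
- by rewrite !newP.
Qed.

(** * Joins as rooted trees *)

Lemma graft_plug c us ts :
  graft (plug c (Node us)) (nseq (size c) 0) ts = plug c (Node (us ++ ts)).
Proof. by elim: c => [|s c IH] //=; rewrite -IH. Qed.

Lemma subtree_at_plug c T : subtree_at (plug c T) (nseq (size c) 0) = T.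
Proof. by elim: c. Qed.

Lemma plug_addresses c T : nseq (size c) 0 \in addresses (plug c T).
Proof. by elim: c => [|s c IH]; rewrite ?nil_addresses // cons_addresses. Qed.

Lemma join_plug c : exists (H : tree) (v w : H),
  [/\ leaf v, leaf w, v != w & forall Ls Rs,
      isomorphic (join v w Ls Rs) (unroot (Node (plug c (Node Rs) :: Ls)))].
Proof.
pose t := Node [:: plug c bullet].
have w_in : nseq (size c).+1 0 \in addresses t.
  by rewrite addresses_nth /= plug_addresses.
exists (unroot t), (SeqSub (nil_addresses t)), (SeqSub w_in).
split; rewrite /leaf ?deg_unroot //= ?subtree_at_plug //.
move=> Ls Rs; have [f [f_bij f_adj f_old]] := attach_graft Ls (nil_addresses t).
pose w : attach (SeqSub (nil_addresses t) : unroot t) (Node Ls) := inl (SeqSub w_in).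
apply: (isomorphic_trans (attach_isomorphic w (Node Rs) f_bij f_adj)).
have w_in' : nseq (size c).+1 0 \in addresses (graft t [::] Ls).
  by rewrite addresses_graft_old ?nil_addresses.
have -> : f w = SeqSub w_in' by apply: val_inj; rewrite /= f_old.
have [g [g_bij g_adj _]] := attach_graft Rs w_in'.
have -> : Node (plug c (Node Rs) :: Ls) =
          graft (graft t [::] Ls) (nseq (size c).+1 0) Rs.
  by rewrite -[Rs in LHS]cat0s -graft_plug.
by exists g.
Qed.

(** * Contracted trees *)

(* In a contracted tree some branches are hidden inside leaves: they count as
   indivisible. The boolean marks the branches that are to be gathered. *)
Inductive ctree := CLeaf of bool & rtree | CNode of seq ctree.

HB.instance Definition _ := gen_eqMixin ctree.

Lemma ctree_nested_ind (P : ctree -> Prop) :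
  (forall b T, P (CLeaf b T)) ->
  (forall xs, (forall x, x \in xs -> P x) -> P (CNode xs)) -> forall x, P x.
Proof.
move=> Pleaf IH; fix loop 1 => -[b T|xs]; first exact: Pleaf.
apply: IH; elim: xs => [|x xs IHxs] y; first by clear loop; rewrite in_nil.
by rewrite inE => /orP[/eqP->|/IHxs].
Qed.

Fixpoint expand (x : ctree) : rtree :=
  match x with CLeaf _ T => T | CNode xs => Node (map expand xs) end.

Fixpoint cleaves (x : ctree) : seq (bool * rtree) :=
  match x with CLeaf b T => [:: (b, T)] | CNode xs => flatten (map cleaves xs) end.

Fixpoint cbranch_degs (x : ctree) : seq nat :=
  match x with
  | CLeaf _ _ => [::]
  | CNode xs => (size xs).+1 :: flatten (map cbranch_degs xs)
  end.

Definition croot_degs (x : ctree) : seq nat :=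
  match x with
  | CLeaf _ _ => [::]
  | CNode xs => size xs :: flatten (map cbranch_degs xs)
  end.

Definition marked (x : ctree) : bool := if x is CLeaf b _ then b else false.

Definition cplug (c : seq (seq ctree)) (x : ctree) : ctree :=
  foldr (fun s a => CNode (a :: s)) x c.

Lemma expand_cplug c x : expand (cplug c x) = plug (map (map expand) c) (expand x).
Proof. by elim: c => //= s c ->. Qed.

Lemma perm_cons2 (T : eqType) (x y : T) (s : seq T) :
  perm_eq (x :: y :: s) (y :: x :: s).
Proof. by rewrite -[x :: _]/([:: x] ++ [:: y] ++ s) perm_catCA. Qed.

Lemma branch_degs_expand x : perm_eq (branch_degs (expand x))
  (cbranch_degs x ++ flatten (map branch_degs (map snd (cleaves x)))).
Proof.
elim/ctree_nested_ind: x => [b T|xs IH] /=; first by rewrite cats0.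
rewrite size_map perm_cons; elim: xs IH => //= x xs IHxs IH.
rewrite map_cat map_cat flatten_cat.
rewrite perm_sym -catA perm_catCA perm_sym.
apply: (@perm_trans _ (cbranch_degs x ++
  flatten (map branch_degs (map snd (cleaves x))) ++
  flatten (map branch_degs (map expand xs)))).
  by rewrite catA perm_cat2r IH ?mem_head.
rewrite perm_sym perm_catCA perm_cat2l perm_catCA perm_cat2l perm_sym.
by apply: IHxs => y y_in; apply: IH; rewrite inE y_in orbT.
Qed.

Lemma root_degs_expand xs : perm_eq (root_degs (expand (CNode xs)))
  (croot_degs (CNode xs) ++
   flatten (map branch_degs (map snd (cleaves (CNode xs))))).
Proof.
have := branch_degs_expand (CNode xs).
by rewrite /= /root_degs /= size_map !perm_cons.
Qed.

(* The handshake lemma: the leaves have degree one. *)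
Lemma sumn_croot_degs xs :
  sumn (croot_degs (CNode xs)) + 2 =
  size (cleaves (CNode xs)) + (size (croot_degs (CNode xs))).*2.
Proof.
(* A branch has one more edge, to its parent, hence 1 in place of 2. *)
suff branch x :
    sumn (cbranch_degs x) + 1 = size (cleaves x) + (size (cbranch_degs x)).*2.
  by have := branch (CNode xs); rewrite /=; lia.
elim/ctree_nested_ind: x => [b T|ys IH] //=.
suff : size ys + sumn (flatten (map cbranch_degs ys)) =
       size (flatten (map cleaves ys)) + (size (flatten (map cbranch_degs ys))).*2.
  by move=> E; rewrite addn1 addSn E doubleS !addnS.
elim: ys IH => //= y ys IHys IH; have Ey := IH y (mem_head _ _).
have /IHys : forall z, z \in ys -> sumn (cbranch_degs z) + 1 =
    size (cleaves z) + (size (cbranch_degs z)).*2.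
  by move=> z z_in; apply: IH; rewrite inE z_in orbT.
by rewrite sumn_cat !size_cat; lia.
Qed.

(** * Exchanging branches *)

Section Exchange.
Context {R : realType} (rho : rtree -> R) (I : tree -> R).
Hypothesis I_inv : tree_invariant I.
Hypothesis I_compat : max_compatible rho I.

Definition better (t u : rtree) : Prop :=
  (I (unroot t) <= I (unroot u))%R /\ perm_eq (root_degs t) (root_degs u).

Lemma better_trans t u v : better t u -> better u v -> better t v.
Proof.
move=> [le_tu eq_tu] [le_uv eq_uv].
by split; [apply: le_trans le_uv | apply: perm_trans eq_uv].
Qed.

Lemma isomorphic_better t u : isomorphic (unroot t) (unroot u) -> better t u.
Proof.
move=> iso; split; first by rewrite (I_inv iso).
have := isomorphic_degree_seq iso; rewrite !degree_seq_unroot => eq_sort.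
by rewrite -(perm_sort geq) eq_sort perm_sort.
Qed.

Lemma I_unroot_perm ts us : perm_eq ts us ->
  I (unroot (Node ts)) = I (unroot (Node us)).
Proof. by move=> /unroot_perm/I_inv. Qed.

Lemma I_unroot_reroot ts us :
  I (unroot (Node (Node ts :: us))) = I (unroot (Node (Node us :: ts))).
Proof. exact/I_inv/unroot_reroot. Qed.

(** Compatibility with [s = size top]. The size condition says [r - s <= k <= s] for [k = size Rs],
    so the tree with [Rs] at the root and [Ls] at the far end is among the arrangements. *)
Lemma exchange c Ls Rs top bot :
  perm_eq (Rs ++ Ls) (top ++ bot) ->
  sorted >=%R (map rho (top ++ bot)) ->
  size bot <= size Rs <= size top ->
  let J Xs Ys := I (unroot (Node (plug c (Node Ys) :: Xs))) in
  (J Rs Ls <= J top bot)%R \/ (J Rs Ls <= J bot top)%R.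
Proof.
move=> perm_tb sorted_tb /andP[le_bR le_Rt] J.
have [H [v [w [v_leaf w_leaf vw joinE]]]] := join_plug c.
have JE Xs Ys : I (join v w Xs Ys) = J Xs Ys by apply: I_inv.
pose ts := in_tuple (top ++ bot).
have size_ts : size (top ++ bot) = size top + size bot by rewrite size_cat.
have arr : arrangements v w ts (size top) (join v w Rs Ls).
  have /tuple_permP[sigma sigmaE] : perm_eq (Rs ++ Ls) ts by [].
  exists sigma, (size Rs); first by rewrite {1}size_ts addKn le_bR.
  have usE : [seq tnth ts (sigma i) | i <- enum 'I_(size (top ++ bot))] = Rs ++ Ls.
    by rewrite sigmaE.
  by rewrite usE /= take_size_cat // drop_size_cat.
have r_le : size (top ++ bot) <= (size top).*2.
  by rewrite size_ts -addnn leq_add2l (leq_trans le_bR).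
have r_ge : size top <= size (top ++ bot) by rewrite size_ts leq_addr.
have := I_compat v_leaf w_leaf vw (ts := ts) sorted_tb r_le r_ge.
rewrite /= take_size_cat // drop_size_cat // !JE => max_ts.
have J_in : values_on (arrangements v w ts (size top)) I (J Rs Ls).
  by exists (join v w Rs Ls).
by case: max_ts => -[_ /(_ _ J_in)]; [left|right].
Qed.

Definition cbetter (x y : ctree) : Prop :=
  [/\ (I (unroot (expand x)) <= I (unroot (expand y)))%R,
      perm_eq (cleaves x) (cleaves y) & perm_eq (croot_degs x) (croot_degs y)].

Lemma cbetter_refl x : cbetter x x.
Proof. by []. Qed.

Lemma cbetter_trans x y z : cbetter x y -> cbetter y z -> cbetter x z.
Proof.
move=> [le_xy eq_xy deg_xy] [le_yz eq_yz deg_yz].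
by split; [apply: le_trans le_yz|apply: perm_trans eq_yz|apply: perm_trans deg_yz].
Qed.

Lemma cbetter_better xs ys :
  cbetter (CNode xs) (CNode ys) -> better (expand (CNode xs)) (expand (CNode ys)).
Proof.
case=> le_xy eq_xy deg_xy; split=> //.
rewrite (permPl (root_degs_expand xs)) perm_sym (permPl (root_degs_expand ys)).
by rewrite perm_sym perm_cat // perm_flatten // !perm_map.
Qed.

Lemma cbetter_perm xs ys : perm_eq xs ys -> cbetter (CNode xs) (CNode ys).
Proof.
move=> eq_xy; split; first by rewrite /= (I_unroot_perm (perm_map expand eq_xy)).
  by rewrite /= perm_flatten ?perm_map.
by rewrite /= (perm_size eq_xy) perm_cons perm_flatten ?perm_map.
Qed.

Lemma cbetter_reroot xs ys :
  cbetter (CNode (CNode xs :: ys)) (CNode (CNode ys :: xs)).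
Proof.
split; first by rewrite /= I_unroot_reroot.
  by rewrite /= perm_catC.
rewrite /= perm_sym (permPl (perm_cons2 _ _ _)) !perm_cons perm_catC.
by [].
Qed.

(** Rerooting edge by edge along the chain turns it around, so its two ends are interchangeable. *)
Lemma cbetter_rev_plug c xs ys :
  cbetter (CNode (cplug c (CNode xs) :: ys)) (CNode (cplug (rev c) (CNode ys) :: xs)).
Proof.
elim: c ys => [|s c IH] ys; first exact: cbetter_reroot.
apply: (cbetter_trans (cbetter_reroot _ _)).
apply: (cbetter_trans (cbetter_perm (perm_cons2 _ _ _))).
by apply: (cbetter_trans (IH _)); rewrite rev_cons /cplug foldr_rcons.
Qed.

Lemma cplug_cleaves c : exists F, forall xs,
  perm_eq (cleaves (cplug c (CNode xs))) (F ++ flatten (map cleaves xs)).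
Proof.
elim: c => [|s c [F FP]]; first by exists [::].
exists (F ++ flatten (map cleaves s)) => xs /=.
by rewrite perm_sym perm_catAC perm_sym perm_cat2r FP.
Qed.

Lemma cplug_degs c : exists F, forall xs,
  perm_eq (cbranch_degs (cplug c (CNode xs)))
          ((size xs).+1 :: F ++ flatten (map cbranch_degs xs)).
Proof.
elim: c => [|s c [F FP]]; first by exists [::].
exists ((size s).+2 :: F ++ flatten (map cbranch_degs s)) => xs /=.
rewrite perm_sym (permPl (perm_cons2 _ _ _)) perm_cons perm_sym.
by rewrite perm_sym -!cat_cons perm_catAC perm_sym perm_cat2r FP.
Qed.

Lemma cexchange c Ls Rs top bot :
  perm_eq (Rs ++ Ls) (top ++ bot) ->
  sorted >=%R (map (rho \o expand) (top ++ bot)) ->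
  size bot <= size Rs <= size top ->
  let J xs ys := I (unroot (expand (CNode (cplug c (CNode ys) :: xs)))) in
  (J Rs Ls <= J top bot)%R \/ (J Rs Ls <= J bot top)%R.
Proof.
move=> perm_tb sorted_tb size_tb J; rewrite /J /= !expand_cplug.
apply: exchange; rewrite ?size_map // -!map_cat ?perm_map // -map_comp //.
Qed.

Lemma perm_cleaves_plug c : exists F, forall Xs Ys,
  perm_eq (cleaves (CNode (cplug c (CNode Ys) :: Xs)))
          (F ++ flatten (map cleaves (Xs ++ Ys))).
Proof.
have [F FP] := cplug_cleaves c; exists F => Xs Ys.
rewrite /= map_cat flatten_cat perm_sym perm_catCA perm_sym perm_catC.
by rewrite perm_cat2l FP.
Qed.

Lemma perm_croot_degs_plug c : exists F, forall Xs Ys,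
  perm_eq (croot_degs (CNode (cplug c (CNode Ys) :: Xs)))
    (map S [:: size Xs; size Ys] ++ F ++ flatten (map cbranch_degs (Xs ++ Ys))).
Proof.
have [F FP] := cplug_degs c; exists F => Xs Ys.
rewrite /= perm_cons map_cat flatten_cat perm_sym -cat_cons perm_catCA perm_sym.
by rewrite perm_catC perm_cat2l FP.
Qed.

Lemma perm_cleaves_exchange c Ls Rs U V : perm_eq (Rs ++ Ls) (U ++ V) ->
  perm_eq (cleaves (CNode (cplug c (CNode Ls) :: Rs)))
          (cleaves (CNode (cplug c (CNode V) :: U))).
Proof.
have [F FP] := perm_cleaves_plug c.
move=> perm_UV; rewrite (permPl (FP _ _)) perm_sym (permPl (FP _ _)).
by rewrite perm_cat2l perm_flatten // perm_map // perm_sym.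
Qed.

Lemma perm_croot_degs_exchange c Ls Rs U V : perm_eq (Rs ++ Ls) (U ++ V) ->
  perm_eq [:: size Rs; size Ls] [:: size U; size V] ->
  perm_eq (croot_degs (CNode (cplug c (CNode Ls) :: Rs)))
          (croot_degs (CNode (cplug c (CNode V) :: U))).
Proof.
have [F FP] := perm_croot_degs_plug c => perm_UV size_UV.
rewrite (permPl (FP _ _)) perm_sym (permPl (FP _ _)) perm_sym.
by rewrite perm_cat ?perm_map // perm_cat2l perm_flatten // perm_map.
Qed.

(* Whichever end receives [U], the tree can be rooted there. *)
Lemma cexchange_same_size c Ls Rs U V :
  perm_eq (Rs ++ Ls) (U ++ V) -> size U = size Rs ->
  sorted >=%R (map (rho \o expand) (U ++ V)) && (size Ls <= size Rs) ||
  sorted >=%R (map (rho \o expand) (V ++ U)) && (size Rs <= size Ls) ->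
  exists c', cbetter (CNode (cplug c (CNode Ls) :: Rs))
                     (CNode (cplug c' (CNode V) :: U)).
Proof.
move=> perm_UV size_U ord_UV.
have perm_VU : perm_eq (Rs ++ Ls) (V ++ U) by rewrite (permPl perm_UV) perm_catC.
have size_V : size V = size Ls.
  by have := perm_size perm_UV; rewrite !size_cat size_U => /addnI.
pose J xs ys := I (unroot (expand (CNode (cplug c (CNode ys) :: xs)))).
have {ord_UV}[le_J|le_J] : (J Rs Ls <= J U V)%R \/ (J Rs Ls <= J V U)%R.
- case/orP: ord_UV => /andP[ord_UV le_size].
    by apply: cexchange; rewrite // size_V size_U le_size /=.
  suff [] : (J Rs Ls <= J V U)%R \/ (J Rs Ls <= J U V)%R by [right|left].
  by apply: cexchange; rewrite // size_V size_U leqnn.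
- exists c; split; [exact: le_J|exact: perm_cleaves_exchange|].
  by apply: perm_croot_degs_exchange; rewrite // size_U size_V.
exists (rev c).
suff : cbetter (CNode (cplug c (CNode Ls) :: Rs)) (CNode (cplug c (CNode U) :: V)).
  by move=> /cbetter_trans; apply; apply: cbetter_rev_plug.
split; [exact: le_J|exact: perm_cleaves_exchange|].
by apply: perm_croot_degs_exchange; rewrite // size_U size_V perm_cons2.
Qed.

(** * Rerooting at a chosen vertex and gathering the marked leaves *)

Fixpoint has_node (p : pred (seq ctree)) (x : ctree) : bool :=
  if x is CNode xs then p xs || has (has_node p) xs else false.

(** To descend one level, the tree is rerooted at the child, which turns the rest, [CNode ys], into
    one more branch there; the induction hypothesis holds for any siblings, and the root is then
    moved back. *)
Lemma expose_node p x : has_node p x -> exists c xs, p xs /\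
  forall ys, cbetter (CNode (x :: ys)) (CNode (cplug c (CNode xs) :: ys)).
Proof.
elim/ctree_nested_ind: x => // xs IH /= /orP[p_xs|/hasP[x x_in x_p]].
  by exists [::], xs; split=> // ys; apply: cbetter_refl.
have [c [zs [p_zs zsP]]] := IH x x_in x_p.
have perm_xs := perm_to_rem x_in; set xs' := rem x xs in perm_xs.
exists (xs' :: c), zs; split=> // ys.
apply: (cbetter_trans (cbetter_reroot _ _)).
have perm_swap : perm_eq (CNode ys :: xs) (x :: CNode ys :: xs').
  by rewrite perm_sym (permPl (perm_cons2 _ _ _)) perm_cons perm_sym.
apply: (cbetter_trans (cbetter_perm perm_swap)).
apply: (cbetter_trans (zsP _)).
apply: (cbetter_trans (cbetter_perm (perm_cons2 _ _ _))).
exact: cbetter_reroot.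
Qed.

Lemma mem_cbranch_degs d x :
  (d \in cbranch_degs x) = has_node (fun xs => (size xs).+1 == d) x.
Proof.
elim/ctree_nested_ind: x => [//|xs IH] /=; rewrite inE eq_sym; congr orb.
elim: xs IH => //= x xs IHxs IH; rewrite mem_cat IH ?mem_head // IHxs // => y y_in.
by apply: IH; rewrite inE y_in orbT.
Qed.

Lemma reroot_degree d xs : d \in croot_degs (CNode xs) ->
  exists ys, cbetter (CNode xs) (CNode ys) /\ size ys = d.
Proof.
rewrite inE => /orP[/eqP->|]; first by exists xs; split=> //; apply: cbetter_refl.
case/flattenP => s /mapP[x x_in ->]; rewrite mem_cbranch_degs => /expose_node.
case=> c [zs [/eqP size_zs zsP]].
exists (cplug (rev c) (CNode (rem x xs)) :: zs); split=> //.
apply: (cbetter_trans (cbetter_perm (perm_to_rem x_in))).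
by apply: (cbetter_trans (zsP _)); apply: cbetter_rev_plug.
Qed.

(** Multiplicities are ignored: the property then passes to the branches of [x], and bounds on [rho]
    follow by structural induction. *)
Definition built_from (F : seq rtree) (D : seq nat) (x : ctree) : Prop :=
  {subset map snd (cleaves x) <= F} /\ {subset cbranch_degs x <= D}.

(** [true] stands for gathering the largest values at a vertex of greatest degree, [false] for the
    smallest values at a vertex of least degree. *)
Definition ahead (b : bool) (x y : R) : bool := if b then (y <= x)%R else (x <= y)%R.

(* The leaves [A] are just enough to fill up a vertex of degree [d], and they are
   the first to go to a vertex of this degree in an exchange. *)
Definition gatherable b A rest D d : Prop :=
  [/\ size A = d.-1, {in D, forall e, if b then e <= d else d <= e},
      {in A & rest, forall S T, ahead b (rho S) (rho T)} &
      forall S xs, S \in A -> built_from (A ++ rest) D (CNode xs) ->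
        ahead b (rho S) (rho (expand (CNode xs)))].

Lemma count_marked_cleaves xs :
  count marked xs <= count fst (flatten (map cleaves xs)).
Proof.
elim: xs => //= x xs IH; rewrite count_cat leq_add //.
by case: x => //= b T; rewrite addn0.
Qed.

Section Gather.
Variables (b : bool) (A rest : seq rtree) (D : seq nat) (d : nat).
Hypothesis A_gatherable : gatherable b A rest D d.

Let M := map (pair true) A ++ map (pair false) rest.

Let count_M : count fst M = d.-1.
Proof.
have [<- _ _ _] := A_gatherable.
by rewrite count_cat !count_map /= count_predT count_pred0 addn0.
Qed.

Let snd_M : map snd M = A ++ rest.
Proof. by rewrite map_cat -!map_comp !map_id. Qed.

(** All marked branches precede the unmarked ones if [b], and follow them otherwise; each class is
    sorted by [rho]. The tree has only [d.-1] marked leaves, so the [d.-1] branches of [U] at the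
    marked end of this order include every marked branch from both vertices. *)
Lemma gather_exchange c Ls Rs :
  perm_eq (cleaves (CNode (cplug c (CNode Ls) :: Rs))) M ->
  perm_eq (croot_degs (CNode (cplug c (CNode Ls) :: Rs))) D ->
  size Rs = d.-1 ->
  exists c' U V, [/\ cbetter (CNode (cplug c (CNode Ls) :: Rs))
                             (CNode (cplug c' (CNode V) :: U)),
    size U = d.-1 & count marked U = count marked Rs + count marked Ls].
Proof.
have [size_A D_d A_rest A_over] := A_gatherable.
have [F FP] := perm_cleaves_plug c; have [G GP] := perm_croot_degs_plug c.
rewrite (permPl (FP _ _)) (permPl (GP _ _)) => leavesM degsD size_Rs.
set us := Rs ++ Ls in leavesM degsD *.
have us_leaves x : x \in us -> {subset cleaves x <= M}.
  move=> x_in y y_in; rewrite -(perm_mem leavesM) mem_cat; apply/orP; right.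
  by apply/flattenP; exists (cleaves x); rewrite ?map_f.
have us_degs x : x \in us -> {subset cbranch_degs x <= D}.
  move=> x_in y y_in; rewrite -(perm_mem degsD) !mem_cat; apply/orP; right.
  by apply/orP; right; apply/flattenP; exists (cbranch_degs x); rewrite ?map_f.
(* An unmarked competitor is a leaf from [rest] or an inner branch; [gatherable] has one clause for
   each. *)
have ahead_us x y : x \in us -> y \in us -> marked x -> ~~ marked y ->
    ahead b (rho (expand x)) (rho (expand y)).
  move=> x_in y_in; case: x x_in => // -[] S //= S_in _ y_unmarked.
  have {}S_in : S \in A.
    have := us_leaves _ S_in (true, S) (mem_head _ _).
    by rewrite mem_cat => /orP[/mapP[T T_in [->]]|/mapP[T _ []]].
  case: y y_in y_unmarked => [[//|] T|ys] y_in _.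
    have := us_leaves _ y_in (false, T) (mem_head _ _).
    rewrite mem_cat => /orP[/mapP[T' _ []]|/mapP[T' T'_in [->]]] //.
    exact: A_rest.
  apply: A_over => //; split; last exact: us_degs.
  by move=> T /mapP[z z_in ->]; rewrite -snd_M map_f // (us_leaves _ y_in).
have few_marked : count marked us <= d.-1.
  rewrite -count_M -(seq.permP leavesM) [X in _ <= X]count_cat.
  by apply: leq_trans (count_marked_cleaves us) (leq_addl _ _).
have Ls_D : (size Ls).+1 \in D by rewrite -(perm_mem degsD) !inE eqxx orbT.
pose ge x y := (rho (expand y) <= rho (expand x))%R.
have ge_tr : transitive ge by move=> y x z /[swap]; apply: le_trans.
have ge_total : total ge by move=> x y; rewrite /ge orbC le_total.
pose N := sort ge (filter marked us); pose O := sort ge (filter (predC marked) us).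
have perm_NO : perm_eq (N ++ O) us.
  apply: (@perm_trans _ (filter marked us ++ filter (predC marked) us)).
    by apply: perm_cat; rewrite perm_sort.
  by rewrite perm_filterC.
have size_N : size N <= d.-1 by rewrite size_sort size_filter.
have size_NO : size N + size O = d.-1 + size Ls.
  by rewrite -size_cat (perm_size perm_NO) size_cat size_Rs.
have N_in x : x \in N -> (x \in us) && marked x.
  by rewrite mem_sort mem_filter andbC.
have O_in x : x \in O -> (x \in us) && ~~ marked x.
  by rewrite mem_sort mem_filter andbC.
have sorted_rho s : pairwise ge s -> sorted >=%R (map (rho \o expand) s).
  by rewrite -(sorted_pairwise ge_tr) sorted_map.
(* If [b], then [d] is the greatest degree and [U] is the longer, leading part; otherwise [d] is the
   least degree and [U] is the shorter, trailing part. *)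
have [U [V [perm_UV size_U ord_UV V_O]]] : exists U V,
    [/\ perm_eq us (U ++ V), size U = d.-1,
      pairwise ge (U ++ V) && (size Ls <= size Rs) ||
      pairwise ge (V ++ U) && (size Rs <= size Ls) & {subset V <= O}].
  have /D_d := Ls_D; rewrite size_Rs; case: b ahead_us => ahead_us le_d.
    exists (take d.-1 (N ++ O)), (drop d.-1 (N ++ O)).
    rewrite cat_take_drop; split.
    - by rewrite perm_sym.
    - rewrite size_take_min (perm_size perm_NO) size_cat size_Rs.
      by rewrite (minn_idPl _) ?leq_addr.
    - rewrite pairwise_cat -!sorted_pairwise // !sort_sorted // -ltnS.
      rewrite (leq_trans le_d) ?leqSpred // !andbT; apply/orP; left.
      apply/allrelP => x y /N_in/andP[x_in x_m] /O_in/andP[y_in y_m].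
      exact: ahead_us.
    by move=> x; rewrite drop_cat ltnNge size_N /= => /mem_drop.
  have le_O : size Ls <= size O by move: size_NO size_N; lia.
  exists (drop (size Ls) (O ++ N)), (take (size Ls) (O ++ N)).
  rewrite cat_take_drop; split.
  - by rewrite perm_sym perm_catC cat_take_drop perm_catC.
  - by rewrite size_drop size_cat addnC size_NO addnK.
  - have le_d' : d.-1 <= size Ls by move: le_d; lia.
    rewrite [X in _ || X]andbC pairwise_cat -!sorted_pairwise // !sort_sorted // le_d' /=.
    rewrite !andbT; apply/orP; right; apply/allrelP => x y.
    by move=> /O_in/andP[x_in x_m] /N_in/andP[y_in y_m]; apply: ahead_us.
  by move=> x; rewrite takel_cat // => /mem_take.
have [||c' bet] := @cexchange_same_size c Ls Rs U V perm_UV.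
- by rewrite size_Rs.
- case/orP: ord_UV => /andP[/sorted_rho-> ->] //.
  by rewrite orbT.
exists c', U, V; split=> //.
rewrite -count_cat (seq.permP perm_UV) count_cat [X in _ + X](_ : _ = 0) ?addn0 //.
by apply/eqP; rewrite eqn0Ngt -has_count; apply/hasPn => x /V_O/O_in/andP[].
Qed.

(** Induction on the number of marked leaves missing at the root. Each exchange is with an inner
    vertex carrying at least one of them, and the end that receives [U] becomes the new root. *)
Lemma gather xs : size xs = d -> 0 < d -> 1 < size D ->
  perm_eq (cleaves (CNode xs)) M -> perm_eq (croot_degs (CNode xs)) D ->
  exists ys zs, [/\ cbetter (CNode xs) (CNode (CNode ys :: zs)),
                    all marked zs & size zs = d.-1].
Proof.
move=> + d_gt0 D_gt1; have [n] := ubnP (d.-1 - count marked xs).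
elim: n xs => // n IH xs le_n size_xs leavesM degsD.
have few_marked : count marked xs <= d.-1.
  by rewrite -count_M -(seq.permP leavesM) count_marked_cleaves.
have size_rem x : x \in xs -> size (rem x xs) = d.-1.
  by move=> x_in; rewrite size_rem // size_xs.
have [all_marked|] := eqVneq (count marked xs) d.-1.
  have /allPn[x x_in x_m] : ~~ all marked xs.
    by rewrite all_count all_marked size_xs neq_ltn prednK ?leqnn.
  have perm_xs := perm_to_rem x_in.
  have zs_marked : all marked (rem x xs).
    move: all_marked; rewrite (seq.permP perm_xs) /= (negPf x_m) add0n.
    by rewrite all_count size_rem // => ->.
  (* Were the one unmarked branch a leaf too, the root would be the only vertex left, against
     [1 < size D]. *)
  case: x x_in x_m perm_xs zs_marked => [[//|] T|ys] x_in _ perm_xs zs_marked.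
    have no_degs : flatten (map cbranch_degs xs) = [::].
      case E: (flatten _) => [//|e s].
      have /flattenP[s' /mapP[y y_in ->]] : e \in flatten (map cbranch_degs xs).
        by rewrite E mem_head.
      move: y_in; rewrite (perm_mem perm_xs) inE => /orP[/eqP-> //|].
      by move=> /(allP zs_marked); case: y.
    by have := perm_size degsD; rewrite /= no_degs => E; rewrite -E in D_gt1.
  by exists ys, (rem (CNode ys) xs); split=> //; [apply: cbetter_perm|apply: size_rem].
move=> not_all.
(* Otherwise all [d.-1] marked leaves would already be at the root. *)
have [x x_in x_node] : exists2 x, x \in xs & has_node (has marked) x.
  apply/hasP; apply: contraR not_all => no_node; apply/eqP.
  rewrite -count_M -(seq.permP leavesM) /=.
  have leaves_marked x :
      ~~ has_node (has marked) x -> count fst (cleaves x) = marked x.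
    elim/ctree_nested_ind: x => [b' T|ys IHys] /=; first by rewrite addn0.
    rewrite negb_or => /andP[]; elim: ys IHys => //= y ys IHys' IHys.
    rewrite !negb_or => /andP[y_m ys_m] /andP[y_n ys_n].
    rewrite count_cat IHys ?mem_head // (negPf y_m) IHys' // => z z_in.
    by apply: IHys; rewrite inE z_in orbT.
  elim: (xs) no_node => //= y ys IHys; rewrite negb_or => /andP[y_n ys_n].
  by rewrite count_cat leaves_marked // IHys.
have perm_xs := perm_to_rem x_in; have [c [Ls [Ls_m LsP]]] := expose_node x_node.
have {}LsP := cbetter_trans (cbetter_perm perm_xs) (LsP (rem x xs)).
have [le1 leaves1 degs1] := LsP.
have [||c' [U [V [UV_better size_U count_U]]]] :=
    @gather_exchange c Ls (rem x xs) _ _ (size_rem x x_in).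
- by rewrite -(permPl leaves1).
- by rewrite -(permPl degs1).
have {}UV_better := cbetter_trans LsP UV_better; have [_ leaves2 degs2] := UV_better.
have x_m : marked x = false by case: (x) x_node.
have [||||ys [zs [zs_better zs_m size_zs]]] := IH (cplug c' (CNode V) :: U).
- move: le_n; rewrite (seq.permP perm_xs) /= x_m count_U.
  have V_m : marked (cplug c' (CNode V)) = false by case: (c').
  by rewrite V_m; move: Ls_m; rewrite has_count; move: (few_marked) not_all;
    rewrite (seq.permP perm_xs) /= x_m; lia.
- by rewrite /= size_U prednK.
- by rewrite -(permPl leaves2).
- by rewrite -(permPl degs2).
by exists ys, zs; split=> //; apply: cbetter_trans zs_better.
Qed.

End Gather.

(** Marks are chosen afresh for each bundle; they affect neither the expanded tree nor its
    degrees. *)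
Lemma relabel_leaves x M : map snd (cleaves x) = map snd M ->
  exists y, [/\ expand y = expand x, cleaves y = M, cbranch_degs y = cbranch_degs x
             & croot_degs y = croot_degs x].
Proof.
elim/ctree_nested_ind: x M => [b T|xs IH] M /=.
  by case: M => [|[b' T'] []] //= [->]; exists (CLeaf b' T').
suff main : forall M', map snd (flatten (map cleaves xs)) = map snd M' -> exists ys,
    [/\ map expand ys = map expand xs, flatten (map cleaves ys) = M' &
        map cbranch_degs ys = map cbranch_degs xs].
  move=> /main[ys [expE leavesE degsE]]; exists (CNode ys).
  have size_ys : size ys = size xs by rewrite -(size_map expand) expE size_map.
  by rewrite /= expE leavesE degsE size_ys.
elim: xs IH {M} => [_ [|//]|x xs IHxs IH M /=]; first by exists [::].
rewrite map_cat => /eqP; rewrite -[M](cat_take_drop (size (cleaves x))) map_cat.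
have [le_M|lt_M] := leqP (size (cleaves x)) (size M); last first.
  move=> /eqP/(congr1 size).
  by rewrite -!map_cat cat_take_drop !size_map size_cat; lia.
rewrite eqseq_cat; last by rewrite !size_map size_takel.
move=> /andP[/eqP/(IH x (mem_head _ _))[y [yE y_leaves y_degs _]]].
move=> /eqP/IHxs[z z_in|ys [ysE ys_leaves ys_degs]].
  by apply: IH; rewrite inE z_in orbT.
by exists (y :: ys); rewrite /= yE y_leaves y_degs ysE ys_leaves ys_degs.
Qed.

Lemma perm_map_lift (T U : eqType) (f : T -> U) (s : seq T) (t : seq U) :
  perm_eq (map f s) t -> exists2 s', perm_eq s s' & map f s' = t.
Proof.
case: s => [|x0 s] eq_st.
  by exists [::] => //; move: eq_st; rewrite perm_sym => /perm_nilP.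
rewrite perm_sym in eq_st; have /(perm_iotaP (f x0))[Is IsP ->] := eq_st.
rewrite size_map in IsP; exists (map (nth x0 (x0 :: s)) Is).
  by rewrite perm_sym; apply/(perm_iotaP x0); exists Is.
rewrite -map_comp; apply/eq_in_map => i; rewrite (perm_mem IsP) mem_iota add0n.
by move=> i_lt; rewrite /= -(nth_map x0 (f x0)).
Qed.

(* The marked leaves end up on a common neighbour together with a single further
   branch, so that their bundle becomes a leaf. *)
Lemma bundle b A rest D d xs :
  gatherable b A rest D d -> 0 < d -> d \in D -> 1 < size D ->
  perm_eq (map snd (cleaves (CNode xs))) (A ++ rest) ->
  perm_eq (croot_degs (CNode xs)) D ->
  exists ys, [/\ better (expand (CNode xs)) (expand (CNode ys)),
    perm_eq (map snd (cleaves (CNode ys))) (Node A :: rest)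
    & perm_eq (croot_degs (CNode ys)) (rem d D)].
Proof.
move=> A_gatherable d_gt0 d_in D_gt1 leavesA degsD.
pose M := map (pair true) A ++ map (pair false) rest.
have snd_M : map snd M = A ++ rest by rewrite map_cat -!map_comp !map_id.
have [M' perm_M' M'E] : exists2 M', perm_eq M M' &
    map snd M' = map snd (cleaves (CNode xs)).
  by apply: perm_map_lift; rewrite snd_M perm_sym.
have [y [exp1 leaves1 _ degs1]] := relabel_leaves (esym M'E).
case: y exp1 leaves1 degs1 => [b' T _ _ [] //|xs1] exp1 leaves1 degs1.
rewrite -exp1; move: exp1 => _.
have {M'E}leavesM : perm_eq (cleaves (CNode xs1)) M by rewrite leaves1 perm_sym.
have {}degsD : perm_eq (croot_degs (CNode xs1)) D by rewrite degs1.
have [xs2 [better2 size2]] := reroot_degree (etrans (perm_mem degsD d) d_in).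
have [_ leaves2 degs2] := better2.
have [||ys [zs [better3 zs_m size_zs]]] := gather A_gatherable size2 d_gt0 D_gt1.
- by rewrite -(permPl leaves2).
- by rewrite -(permPl degs2).
have {leaves2 degs2 better2}better3 := cbetter_trans better2 better3.
have zsE : zs = map (CLeaf true) (map expand zs).
  by elim: zs zs_m {size_zs better3} => //= -[[] T|] //= zs IHzs /IHzs {1}->.
have cleaves_bundle S : flatten (map cleaves (map (CLeaf true) S)) = map (pair true) S.
  by elim: S => //= T S ->.
have size_A : size A = d.-1 by have [] := A_gatherable.
have leaves3 : perm_eq (cleaves (CNode ys) ++ map (pair true) (map expand zs)) M.
  by have [_ + _] := better3; rewrite (permPl leavesM) perm_sym /= {1}zsE cleaves_bundle.
have all_marked (S : seq rtree) : filter fst (map (pair true) S) = map (pair true) S.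
  by apply/all_filterP; rewrite all_map; apply/allP.
(* There are [d.-1] marked leaves in all, and [zs] has that many. So none is left in [ys], and [zs]
   carries exactly [A]. *)
have perm_zs : perm_eq (map expand zs) A.
  have := perm_filter fst leaves3; rewrite !filter_cat !all_marked.
  rewrite [X in perm_eq _ (_ ++ X)](_ : _ = [::]) ?cats0; last first.
    by elim: (rest).
  move=> perm_marked; have := perm_size perm_marked.
  rewrite size_cat !size_map size_zs size_A => /eqP.
  rewrite -[X in _ == X]add0n eqn_add2r => /nilP ys_unmarked.
  rewrite ys_unmarked cat0s in perm_marked.
  by have := perm_map snd perm_marked; rewrite -!map_comp !map_id.
have {leaves3}leaves3 : perm_eq (cleaves (CNode ys)) (map (pair false) rest).
  rewrite -(perm_cat2l (map (pair true) A)) -(permPr leaves3) perm_catC perm_cat2l.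
  by rewrite perm_map // perm_sym.
(* The root moves to the single unmarked branch, so that the gathered leaves form a branch of their
   own, which can be hidden in a leaf. *)
have better4 : cbetter (CNode xs1) (CNode (CNode (map (CLeaf true) A) :: ys)).
  apply: (cbetter_trans better3); apply: cbetter_trans (cbetter_reroot _ _).
  by apply: cbetter_perm; rewrite perm_cons zsE perm_map.
exists (CLeaf false (Node A) :: ys); split.
- have := cbetter_better better4.
  by rewrite /= -map_comp map_id.
- have := perm_map snd leaves3; rewrite -map_comp map_id /= => perm_rest.
  by rewrite perm_cons.
have [_ _ degs4] := better4; move: degs4; rewrite (permPl degsD).
rewrite (permPl (perm_to_rem d_in)) /= size_map size_A prednK //.
have -> : flatten (map cbranch_degs (map (CLeaf true) A)) = [::] by elim: (A).
by rewrite perm_sym (permPl (perm_cons2 _ _ _)) perm_cons.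
Qed.

End Exchange.

(** * Monotone invariants *)

(* [le] is [<=] or [>=], according to whether [f] is increasing or decreasing. *)
Lemma node_monotone (R : realType) (rho : rtree -> R) (f : seq R -> R) (le : rel R) :
  (forall ts, rho (Node ts) = f (map rho ts)) ->
  reflexive le -> transitive le ->
  (forall xs x y ys, rho_values rho (xs ++ x :: ys) ->
     rho_values rho (xs ++ y :: ys) -> (x < y)%R ->
     le (f (xs ++ x :: ys)) (f (xs ++ y :: ys))) ->
  (forall xs ys, rho_values rho (xs ++ ys) -> ys <> [::] -> le (f xs) (f (xs ++ ys))) ->
  forall Xs Ys, size Xs <= size Ys ->
    {in Xs & Ys, forall S T, (rho S <= rho T)%R} ->
    le (rho (Node Xs)) (rho (Node Ys)).
Proof.
move=> rhoE le_refl le_tr le_mono le_app Xs Ys size_XY le_XY; rewrite !rhoE.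
have same_size P Us Vs : size Us = size Vs ->
    {in Us & Vs, forall S T, (rho S <= rho T)%R} ->
    le (f (map rho (P ++ Us))) (f (map rho (P ++ Vs))).
  elim: Us P Vs => [|u Us IH] P [|v Vs] //= [size_UV] le_UV.
  apply: (le_tr (f (map rho (P ++ v :: Us)))); last first.
    rewrite -!cat_rcons; apply: IH => // S T S_in T_in.
    by apply: le_UV; rewrite inE ?S_in ?T_in orbT.
  have := le_UV u v (mem_head _ _) (mem_head _ _).
  rewrite le_eqVlt !map_cat /= => /orP[/eqP-> //|lt_uv].
  by apply: le_mono lt_uv; [exists (P ++ u :: Us)|exists (P ++ v :: Us)]; rewrite map_cat.
apply: (le_tr (f (map rho (take (size Xs) Ys)))).
  apply: (same_size [::]); first by rewrite size_takel.
  by move=> S T S_in /mem_take; apply: le_XY.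
rewrite -[in X in le _ X](cat_take_drop (size Xs) Ys) map_cat.
case: (drop _ _) => [|y ys]; first by rewrite /= cats0.
by apply: le_app => //; exists (take (size Xs) Ys ++ y :: ys); rewrite map_cat.
Qed.

Lemma croot_degs_gt0 xs :
  1 < size (croot_degs (CNode xs)) -> {in croot_degs (CNode xs), forall d, 0 < d}.
Proof.
case: xs => //= x xs _ d; rewrite inE => /orP[/eqP-> //|].
rewrite -[_ ++ _]/(flatten (map cbranch_degs (x :: xs))).
case/flattenP => s /mapP[y _ ->].
elim/ctree_nested_ind: y => //= ys IH; rewrite inE => /orP[/eqP-> //|].
by case/flattenP => s' /mapP[z z_in ->]; apply: IH.
Qed.

Lemma expand_leaves xs : size (croot_degs (CNode xs)) = 1 ->
  map expand xs = map snd (cleaves (CNode xs)).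
Proof.
rewrite /= => -[/size0nil]; elim: xs => //= -[b T|//] xs IH /IH ->.
by [].
Qed.

(** Even a vertex without children becomes a [CNode], so its degree 1 is among the degrees to be
    contracted. *)
Fixpoint uncontracted (t : rtree) : ctree :=
  let: Node ts := t in CNode (map uncontracted ts).

Lemma uncontractedP t : [/\ expand (uncontracted t) = t,
  cleaves (uncontracted t) = [::] & croot_degs (uncontracted t) = root_degs t].
Proof.
suff branch : [/\ expand (uncontracted t) = t,
    cleaves (uncontracted t) = [::] & cbranch_degs (uncontracted t) = branch_degs t].
  by case: t branch => ts [-> ->] /= [-> ->].
elim/rtree_nested_ind: t => ts IH /=; rewrite size_map.
suff [-> -> ->] : [/\ map expand (map uncontracted ts) = ts,
    flatten (map cleaves (map uncontracted ts)) = [::] &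
    flatten (map cbranch_degs (map uncontracted ts)) = flatten (map branch_degs ts)].
  by [].
elim: ts IH => //= t ts IHts IH; have [-> -> ->] := IH t (mem_head _ _).
have [|-> -> ->] := IHts; last by [].
by move=> u u_in; apply: IH; rewrite inE u_in orbT.
Qed.

Lemma double_size_le_sumn s : all (leq 2) s -> (size s).*2 <= sumn s.
Proof. by elim: s => //= d s IH /andP[d_ge2 /IH]; lia. Qed.

Lemma built_fromW (F F' : seq rtree) (D D' : seq nat) x :
  {subset F <= F'} -> {subset D <= D'} -> built_from F D x -> built_from F' D' x.
Proof.
by move=> FF' DD' [F_x D_x]; split=> y; [move=> /F_x/FF'|move=> /D_x/DD'].
Qed.

Lemma built_from_branch F D xs x :
  built_from F D (CNode xs) -> x \in xs -> built_from F D x.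
Proof.
move=> [F_xs D_xs] x_in; split=> y y_in.
  apply: F_xs; move: y_in => /mapP[z z_in ->]; apply: map_f => /=.
  by apply/flattenP; exists (cleaves x); rewrite ?map_f.
by apply: D_xs; rewrite inE; apply/orP; right; apply/flattenP;
  exists (cbranch_degs x); rewrite ?map_f.
Qed.

(** * Greedy trees *)

(** [L] is kept in order of decreasing [rho]: the smallest branches are at the end, and the new
    bundle, at least as large as all others, goes to the front. *)
Definition huffman_step (d : nat) (L : seq rtree) : seq rtree :=
  Node (drop (size L - d.-1) L) :: take (size L - d.-1) L.

Section Increasing.
Context {R : realType} (rho : rtree -> R) (I : tree -> R).
Hypothesis I_inv : tree_invariant I.
Hypothesis I_compat : max_compatible rho I.
Hypothesis rho_mono : forall Xs Ys, size Xs <= size Ys ->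
  {in Xs & Ys, forall S T, (rho S <= rho T)%R} -> (rho (Node Xs) <= rho (Node Ys))%R.

(* [Xs] is the bundle formed last. *)
Definition huffman_inv (L : seq rtree) (D : seq nat) (Xs : seq rtree) : Prop :=
  [/\ sorted >=%R (map rho L), {in Xs & L, forall S T, (rho S <= rho T)%R},
      {in L, forall T, (rho T <= rho (Node Xs))%R},
      {in Xs, forall T, (rho T <= rho (Node Xs))%R} &
      {in D, forall d, size Xs <= d.-1}].

(** Every vertex left has at least as many children as [Xs] has entries, and none of its children is
    smaller than an entry of [Xs]. The latter is proved along the way, for leaves as well as for
    inner branches. *)
Lemma huffman_inv_built_from L D Xs xs :
  huffman_inv L D Xs -> built_from L D (CNode xs) ->
  (rho (Node Xs) <= rho (expand (CNode xs)))%R.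
Proof.
case=> _ Xs_L _ Xs_node Xs_D.
suff main x : built_from L D x -> {in Xs, forall S, (rho S <= rho (expand x))%R} /\
    (if x is CNode _ then (rho (Node Xs) <= rho (expand x))%R else true).
  by move=> /main[].
elim/ctree_nested_ind: x => [b T [T_L _]|ys IH ys_over].
  by split=> // S S_in; apply: Xs_L; rewrite // T_L // mem_head.
suff le_node : (rho (Node Xs) <= rho (expand (CNode ys)))%R.
  by split=> // S /Xs_node/le_trans; apply.
apply: rho_mono.
  by rewrite size_map; have [_ /(_ _ (mem_head _ _))/Xs_D] := ys_over.
move=> S T S_in /mapP[y y_in ->].
by have [/(_ S S_in)] := IH y y_in (built_from_branch ys_over y_in).
Qed.

(** Every step finds enough branches; truncated subtraction in [huffman_step] would conceal a
    shortage. *)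
Fixpoint huffman_fits (L : seq rtree) (D : seq nat) : bool :=
  if D is d :: D' then
    huffman_fits L D' && (d.-1 <= size (foldr huffman_step L D'))
  else true.

Lemma huffman_fits_rcons L D d :
  huffman_fits L (rcons D d) = (d.-1 <= size L) && huffman_fits (huffman_step d L) D.
Proof. by elim: D => [|e D /= ->]; rewrite ?andbT // foldr_rcons andbA. Qed.

(** The contraction takes the degrees from the end of [D]; the greatest is left for the root, hence
    [behead]. *)
Lemma better_huffman (D : seq nat) L Xs xs :
  huffman_inv L D Xs -> sorted geq D ->
  perm_eq (map snd (cleaves (CNode xs))) L -> perm_eq (croot_degs (CNode xs)) D ->
  [/\ better I (expand (CNode xs)) (Node (foldr huffman_step L (behead D))),
      huffman_fits L (behead D) &
      size (foldr huffman_step L (behead D)) = head 0 D].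
Proof.
elim/last_ind: D L Xs xs => [|D d IH] L Xs xs inv sorted_D leavesL degsD.
  by have := perm_size degsD.
have [D0|D_n0] := eqVneq D [::].
  subst D; have /expand_leaves expE := perm_size degsD; split=> //.
    by apply: isomorphic_better => //; apply: unroot_perm; rewrite expE.
  rewrite /= -(perm_size leavesL) -expE size_map.
  by have := perm_mem degsD (size xs); rewrite !inE eqxx => /esym/eqP.
set k := size L - d.-1; set A := drop k L; set rest := take k L.
have D_gt1 : 1 < size (rcons D d) by rewrite size_rcons ltnS lt0n size_eq0.
have D_gt0 : {in rcons D d, forall e, 0 < e}.
  move=> e; rewrite -(perm_mem degsD); apply: croot_degs_gt0.
  by rewrite (perm_size degsD).
have D_ge := sorted_geq_rcons sorted_D.
have d_in : d \in rcons D d by rewrite mem_rcons mem_head.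
(* If [d >= 2], all remaining degrees are at least 2 and the handshake lemma gives enough leaves;
   otherwise [d.-1] is 0. *)
have size_L : d.-1 <= size L.
  have := sumn_croot_degs xs; rewrite (perm_sumn degsD) (perm_size degsD).
  rewrite -(size_map snd) (perm_size leavesL) sumn_rcons size_rcons.
  have [d_ge2|] := leqP 2 d; last by case: (d) => [|[]].
  have /double_size_le_sumn : all (leq 2) D.
    apply/allP => e e_in; apply: leq_trans d_ge2 (D_ge e _).
    by rewrite mem_rcons inE e_in orbT.
  move: (sumn D) (size D) (size L) => /= sD nD nL; lia.
have perm_L : perm_eq L (A ++ rest) by rewrite perm_sym perm_catC cat_take_drop.
have memL : A ++ rest =i L by move=> T; rewrite (perm_mem perm_L).
have size_A : size A = d.-1 by rewrite size_drop subKn.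
have [sorted_L Xs_L L_Xs Xs_node Xs_D] := inv.
have A_rest : {in A & rest, forall S T, (rho S <= rho T)%R}.
  move: sorted_L; rewrite -[X in map _ X](cat_take_drop k) map_cat.
  rewrite sorted_pairwise; last exact: rev_trans le_trans.
  rewrite pairwise_cat => /andP[/allrelP le_LA _] S T S_in T_in.
  by apply: le_LA; apply: map_f.
have A_in S : S \in A -> S \in L by move/mem_drop.
have A_gatherable : gatherable rho false A rest (rcons D d) d.
  split=> //= S ys S_in ys_over.
  have := huffman_inv_built_from inv (built_fromW (F' := L) _ _ ys_over).
  move=> le_Xs; apply: le_trans (L_Xs S (A_in S S_in)) (le_Xs _ _) => //.
  by move=> T; rewrite memL.
have [|ys [better_ys leaves_ys degs_ys]] :=
    bundle I_inv I_compat A_gatherable (D_gt0 d d_in) d_in D_gt1 _ degsD.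
  by rewrite (permPl leavesL).
have {degs_ys}degs_ys : perm_eq (croot_degs (CNode ys)) D.
  by rewrite (permPl degs_ys) -(perm_cons d) -(permPl (perm_to_rem d_in)) perm_rcons.
have node_A : (rho (Node Xs) <= rho (Node A))%R.
  by apply: rho_mono => [|S T S_in T_in]; rewrite ?size_A ?Xs_D // Xs_L // A_in.
have inv' : huffman_inv (huffman_step d L) D A.
  split.
  - rewrite /= path_sortedE; last exact: rev_trans le_trans.
    rewrite -/k -/rest map_take take_sorted // andbT -map_take.
    apply/allP => _ /mapP[T T_in ->] /=; apply: le_trans node_A.
    by apply: L_Xs; apply: mem_take T_in.
  - move=> S T S_in; rewrite inE => /orP[/eqP->|]; last exact: A_rest.
    by apply: le_trans node_A; apply: L_Xs; apply: A_in.
  - move=> T; rewrite inE => /orP[/eqP-> //|/mem_take T_in].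
    by apply: le_trans node_A; apply: L_Xs.
  - by move=> T /A_in T_in; apply: le_trans node_A; apply: L_Xs.
  by move=> e e_in; rewrite size_A -!subn1 leq_sub2r // D_ge // mem_rcons inE e_in orbT.
have sorted_D' : sorted geq D by move: sorted_D; rewrite -cats1 => /cat_sorted2[].
have [better_D fits_D size_D] := IH _ A ys inv' sorted_D' leaves_ys degs_ys.
case: D D_n0 better_D fits_D size_D {IH D_gt1 D_gt0 D_ge inv' sorted_D sorted_D'
  degs_ys A_gatherable d_in degsD Xs_D inv better_ys} (better_trans better_ys better_D)
  => [//|e D] _ _ fits_D size_D better_D.
by rewrite /= -cats1 in fits_D size_D *; rewrite foldr_cat /= cats1 huffman_fits_rcons
  size_L fits_D -[foldr _ (huffman_step _ _) _]/(foldr _ _ _); split.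
Qed.

End Increasing.

(** * M-trees *)

(* The stars are given their leaves from the end of [G], starting with the first
   degree. *)
Fixpoint take_stars (ds : seq nat) (Ss G : seq rtree) : seq rtree * seq rtree :=
  if ds is d :: ds' then
    take_stars ds' (Node (drop (size G - d.-1) G) :: Ss) (take (size G - d.-1) G)
  else (Ss, G).

Lemma take_stars_cat ds es Ss G : take_stars (ds ++ es) Ss G =
  take_stars es (take_stars ds Ss G).1 (take_stars ds Ss G).2.
Proof. by elim: ds Ss G => //= d ds IH Ss G. Qed.

Lemma size_take_stars ds Ss G : size (take_stars ds Ss G).1 = size ds + size Ss.
Proof. by elim: ds Ss G => //= d ds IH Ss G; rewrite IH addnS. Qed.

(* [Mtree_rec] with the branches of [G] in the place of the leaves, in the order of
   the labels. *)
Fixpoint mcontract (fuel : nat) (ds : seq nat) (G : seq rtree) : rtree :=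
  let t := size ds in
  let d := last 0 ds in
  let base := let: (Ss, G') := take_stars (take t.-1 ds) [::] G in Node (Ss ++ G') in
  if fuel isn't fuel'.+1 then base else
  if t <= d.+1 then base else
  let: (Ss, G') := take_stars (take d.-1 ds) [::] G in
  mcontract fuel' (drop d.-1 (take t.-1 ds)) (Node Ss :: G').

Section Decreasing.
Context {R : realType} (rho : rtree -> R) (I : tree -> R).
Hypothesis I_inv : tree_invariant I.
Hypothesis I_compat : max_compatible rho I.
Hypothesis rho_mono : forall Xs Ys, size Xs <= size Ys ->
  {in Xs & Ys, forall S T, (rho S <= rho T)%R} -> (rho (Node Ys) <= rho (Node Xs))%R.

(* The state of the contraction: the leaves are [Ss ++ G], where [G] consists of
   the vertices without children and the bundles of bundles, and [Ss] of the stars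
   waiting to be bundled. [Xs] is the last bundle of stars and [Zs] the last star,
   so that all other branches lie between [Node Zs] and [Node Xs]. *)
Record contraction_inv (G Ss : seq rtree) (D : seq nat) (Xs Zs : seq rtree) : Prop :=
  ContractionInv {
    ci_sorted : sorted <=%R (map rho G);
    ci_G_lb : {in G, forall T, (rho (Node Xs) <= rho T)%R};
    ci_G_ub : {in G & Zs, forall S T, (rho S <= rho T)%R};
    ci_Zs : {in Zs, forall T, (rho (Node Xs) <= rho T)%R};
    ci_Xs : {in Xs, forall T, (rho T <= rho (Node Zs))%R};
    ci_nodes : (rho (Node Zs) <= rho (Node Xs))%R;
    ci_Xs_size : {in D, forall d, size Xs <= d.-1};
    ci_Zs_size : {in D, forall d, d.-1 <= size Zs};
    ci_Ss_ub : {in Ss, forall T, (rho T <= rho (Node Zs))%R};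
    ci_Ss_lb : {in Xs & Ss, forall S T, (rho S <= rho T)%R} }.

(** The two bounds need each other: since a vertex decreases with its children, upper bounds on the
    children yield the lower bound on the vertex, and conversely. *)
Lemma contraction_inv_built_from G Ss D Xs Zs xs :
  contraction_inv G Ss D Xs Zs -> built_from (Ss ++ G) D (CNode xs) ->
  (rho (Node Zs) <= rho (expand (CNode xs)) <= rho (Node Xs))%R.
Proof.
move=> inv; suff main x : built_from (Ss ++ G) D x ->
    [/\ {in Xs, forall S, (rho S <= rho (expand x))%R},
        {in Zs, forall S, (rho (expand x) <= rho S)%R} &
        if x is CNode _ then (rho (Node Zs) <= rho (expand x) <= rho (Node Xs))%R
        else true].
  by move=> /main[].
elim/ctree_nested_ind: x => [b T [/(_ T (mem_head _ _))T_in _]|ys IH ys_from].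
  move: T_in; rewrite mem_cat => /orP[T_in|T_in]; split=> // S S_in /=.
  - exact: (ci_Ss_lb inv).
  - apply: le_trans (ci_Ss_ub inv T_in) _.
    exact: le_trans (ci_nodes inv) (ci_Zs inv S_in).
  - apply: le_trans (ci_Xs inv S_in) _.
    exact: le_trans (ci_nodes inv) (ci_G_lb inv T_in).
  - exact: (ci_G_ub inv).
have size_ys : (size ys).+1 \in D by have [_] := ys_from; apply; apply: mem_head.
have lb : (rho (Node Zs) <= rho (expand (CNode ys)))%R.
  apply: rho_mono; first by rewrite size_map; apply: (ci_Zs_size inv size_ys).
  move=> _ S /mapP[y y_in ->] S_in.
  by have [_ /(_ S S_in)] := IH y y_in (built_from_branch ys_from y_in).
have ub : (rho (expand (CNode ys)) <= rho (Node Xs))%R.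
  apply: rho_mono; first by rewrite size_map; apply: (ci_Xs_size inv size_ys).
  move=> S _ S_in /mapP[y y_in ->].
  by have [/(_ S S_in)] := IH y y_in (built_from_branch ys_from y_in).
split; last by rewrite lb ub.
  by move=> S S_in; apply: le_trans lb; apply: (ci_Xs inv).
by move=> S S_in; apply: le_trans ub _; apply: (ci_Zs inv).
Qed.

Lemma better_star G Ss d ds Xs Zs xs :
  contraction_inv G Ss (d :: ds) Xs Zs -> sorted geq (d :: ds) -> ds <> [::] ->
  all (leq 2) (d :: ds) -> size Ss < (last 0 ds).-1 ->
  perm_eq (map snd (cleaves (CNode xs))) (Ss ++ G) ->
  perm_eq (croot_degs (CNode xs)) (d :: ds) ->
  let A := drop (size G - d.-1) G in let G' := take (size G - d.-1) G in
  exists ys, [/\ better I (expand (CNode xs)) (expand (CNode ys)),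
    perm_eq (map snd (cleaves (CNode ys))) ((Node A :: Ss) ++ G'),
    perm_eq (croot_degs (CNode ys)) ds & contraction_inv G' (Node A :: Ss) ds Xs A].
Proof.
move=> inv sorted_D ds_n0 D_ge2 size_Ss leavesG degsD A G'.
have D_le : {in d :: ds, forall e, e <= d}.
  move: sorted_D; rewrite /= (path_sortedE geq_trans) => /andP[/allP D_le _] e.
  by rewrite inE => /orP[/eqP-> //|/D_le].
(* By the handshake lemma; fewer than [(last 0 ds).-1] of the leaves are stars in waiting, so enough
   others remain. *)
have size_G : d.-1 <= size G.
  have := sumn_croot_degs xs; rewrite (perm_sumn degsD) (perm_size degsD).
  rewrite -(size_map snd) (perm_size leavesG) size_cat.
  move: D_ge2 size_Ss ds_n0; case/lastP: (ds) => // ds' e /= /andP[_].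
  rewrite all_rcons => /andP[_ /double_size_le_sumn].
  rewrite last_rcons sumn_rcons size_rcons => le_ds' size_Ss _.
  move: (sumn ds') (size ds') (size G) (size Ss) le_ds' size_Ss => /=.
  by move=> sD nD nG nS; lia.
have size_A : size A = d.-1 by rewrite size_drop subKn.
have A_in S : S \in A -> S \in G by move/mem_drop.
have G'_in S : S \in G' -> S \in G by move/mem_take.
have perm_G : perm_eq (Ss ++ G) (A ++ (Ss ++ G')).
  by rewrite perm_sym perm_catCA perm_cat2l perm_catC cat_take_drop.
have G'_A : {in A & G', forall S T, (rho T <= rho S)%R}.
  have := ci_sorted inv; rewrite -[X in map _ X](cat_take_drop (size G - d.-1)) map_cat.
  rewrite sorted_pairwise; last exact: le_trans.
  rewrite pairwise_cat => /andP[/allrelP le_GA _] S T S_in T_in.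
  by apply: le_GA; apply: map_f.
have A_gatherable : gatherable rho true A (Ss ++ G') (d :: ds) d.
  split=> // [S T S_in|S ys S_in ys_from] /=.
    rewrite mem_cat => /orP[T_in|]; last exact: G'_A.
    apply: le_trans (ci_Ss_ub inv T_in) _.
    exact: le_trans (ci_nodes inv) (ci_G_lb inv (A_in _ S_in)).
  have /andP[_ ub] : (rho (Node Zs) <= rho (expand (CNode ys)) <= rho (Node Xs))%R.
    apply: contraction_inv_built_from inv _; apply: built_fromW ys_from => // T.
    by rewrite (perm_mem perm_G).
  exact: le_trans ub (ci_G_lb inv (A_in _ S_in)).
have d_in : d \in d :: ds by apply: mem_head.
have D_gt1 : 1 < size (d :: ds) by case: (ds) ds_n0.
have d_gt0 : 0 < d by move: D_ge2 => /andP[/ltnW].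
have [|ys [better_ys leaves_ys degs_ys]] :=
    bundle I_inv I_compat A_gatherable d_gt0 d_in D_gt1 _ degsD.
  by rewrite (permPl leavesG).
rewrite /= eqxx in degs_ys.
have /andP[lb ub] : (rho (Node Zs) <= rho (Node A) <= rho (Node Xs))%R.
  rewrite !rho_mono ?size_A ?(ci_Xs_size inv) ?(ci_Zs_size inv) //.
    move=> S T S_in T_in; apply: le_trans (ci_Xs inv S_in) _.
    exact: le_trans (ci_nodes inv) (ci_G_lb inv (A_in _ T_in)).
  by move=> S T S_in T_in; apply: (ci_G_ub inv) => //; apply: A_in.
exists ys; split=> //; split.
- by rewrite map_take take_sorted // (ci_sorted inv).
- by move=> T /G'_in; apply: (ci_G_lb inv).
- by move=> S T S_in T_in; apply: G'_A.
- by move=> T /A_in; apply: (ci_G_lb inv).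
- by move=> T T_in; apply: le_trans lb; apply: (ci_Xs inv).
- exact: ub.
- by move=> e e_in; apply: (ci_Xs_size inv); rewrite inE e_in orbT.
- by move=> e e_in; rewrite size_A -!subn1 leq_sub2r // D_le // inE e_in orbT.
- move=> T; rewrite inE => /orP[/eqP-> //|T_in].
  exact: le_trans (ci_Ss_ub inv T_in) lb.
move=> S T S_in; rewrite inE => /orP[/eqP->|T_in].
  exact: le_trans (ci_Xs inv S_in) lb.
exact: (ci_Ss_lb inv).
Qed.

(** The waiting stars lie below [Node Zs], hence below all inner branches and all of [G]. Their
    bundle lies below [Node Xs] and so becomes the least entry of [G]. *)
Lemma better_star_bundle G Ss d ds Xs Zs xs :
  contraction_inv G Ss (rcons ds d) Xs Zs -> sorted geq (rcons ds d) -> ds <> [::] ->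
  size Ss = d.-1 -> 0 < d ->
  perm_eq (map snd (cleaves (CNode xs))) (Ss ++ G) ->
  perm_eq (croot_degs (CNode xs)) (rcons ds d) ->
  exists ys, [/\ better I (expand (CNode xs)) (expand (CNode ys)),
    perm_eq (map snd (cleaves (CNode ys))) (Node Ss :: G),
    perm_eq (croot_degs (CNode ys)) ds &
    contraction_inv (Node Ss :: G) [::] ds Ss Zs].
Proof.
move=> inv sorted_D ds_n0 size_Ss d_gt0 leavesG degsD.
have D_ge := sorted_geq_rcons sorted_D.
have d_in : d \in rcons ds d by rewrite mem_rcons mem_head.
have Ss_gatherable : gatherable rho false Ss G (rcons ds d) d.
  split=> //= [S T S_in T_in|S ys S_in ys_from].
    apply: le_trans (ci_Ss_ub inv S_in) _.
    exact: le_trans (ci_nodes inv) (ci_G_lb inv T_in).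
  have /andP[lb _] := contraction_inv_built_from inv ys_from.
  exact: le_trans (ci_Ss_ub inv S_in) lb.
have D_gt1 : 1 < size (rcons ds d) by rewrite size_rcons; case: (ds) ds_n0.
have [ys [better_ys leaves_ys degs_ys]] :=
    bundle I_inv I_compat Ss_gatherable d_gt0 d_in D_gt1 leavesG degsD.
have /andP[lb ub] : (rho (Node Zs) <= rho (Node Ss) <= rho (Node Xs))%R.
  rewrite !rho_mono ?size_Ss ?(ci_Xs_size inv) ?(ci_Zs_size inv) //.
    exact: (ci_Ss_lb inv).
  move=> S T S_in T_in; apply: le_trans (ci_Ss_ub inv S_in) _.
  exact: le_trans (ci_nodes inv) (ci_Zs inv T_in).
exists ys; split=> //.
  rewrite (permPl degs_ys) -(perm_cons d) -(permPl (perm_to_rem d_in)).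
  by rewrite perm_rcons.
split=> //.
- rewrite /= path_sortedE; last exact: le_trans.
  rewrite (ci_sorted inv) andbT; apply/allP => _ /mapP[T T_in ->].
  exact: le_trans ub (ci_G_lb inv T_in).
- move=> T; rewrite inE => /orP[/eqP-> //|T_in].
  exact: le_trans ub (ci_G_lb inv T_in).
- move=> S T; rewrite inE => /orP[/eqP-> T_in|S_in T_in].
    exact: le_trans ub (ci_Zs inv T_in).
  exact: (ci_G_ub inv).
- by move=> T T_in; apply: le_trans ub (ci_Zs inv T_in).
- exact: (ci_Ss_ub inv).
- by move=> e e_in; rewrite size_Ss -!subn1 leq_sub2r // D_ge // mem_rcons inE e_in orbT.
by move=> e e_in; apply: (ci_Zs_size inv); rewrite mem_rcons inE e_in orbT.
Qed.

Lemma better_take_stars es ds G Ss Xs Zs xs :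
  contraction_inv G Ss (es ++ ds) Xs Zs -> sorted geq (es ++ ds) -> ds <> [::] ->
  all (leq 2) (es ++ ds) -> size es + size Ss <= (last 0 ds).-1 ->
  perm_eq (map snd (cleaves (CNode xs))) (Ss ++ G) ->
  perm_eq (croot_degs (CNode xs)) (es ++ ds) ->
  let: (Ss', G') := take_stars es Ss G in
  exists ys Zs', [/\ better I (expand (CNode xs)) (expand (CNode ys)),
    perm_eq (map snd (cleaves (CNode ys))) (Ss' ++ G'),
    perm_eq (croot_degs (CNode ys)) ds & contraction_inv G' Ss' ds Xs Zs'].
Proof.
elim: es G Ss Zs xs => [|e es IH] G Ss Zs xs inv sorted_D ds_n0 D_ge2 size_Ss leavesG degsD.
  by exists xs, Zs.
have last_es : last 0 (es ++ ds) = last 0 ds by rewrite last_cat; case: (ds) ds_n0.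
have [||ys [better_ys leaves_ys degs_ys inv_ys]] :=
    better_star inv sorted_D _ D_ge2 _ leavesG degsD.
- by case: (es) => //.
- by rewrite last_es; move: size_Ss => /=; lia.
have sorted_D' : sorted geq (es ++ ds) by apply: path_sorted sorted_D.
have D'_ge2 : all (leq 2) (es ++ ds) by case/andP: D_ge2.
have := IH _ _ _ ys inv_ys sorted_D' ds_n0 D'_ge2 _ leaves_ys degs_ys.
rewrite /= addnS; case: (take_stars es _ _) => Ss' G' /(_ size_Ss).
case=> zs [Zs' [better_zs leaves_zs degs_zs inv_zs]].
by exists zs, Zs'; split=> //; apply: better_trans better_zs.
Qed.

Lemma better_mcontract fuel ds G Xs Zs xs :
  size ds <= fuel -> contraction_inv G [::] ds Xs Zs -> sorted geq ds ->
  all (leq 2) ds -> perm_eq (map snd (cleaves (CNode xs))) G ->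
  perm_eq (croot_degs (CNode xs)) ds ->
  better I (expand (CNode xs)) (mcontract fuel ds G).
Proof.
elim: fuel ds G Xs Zs xs => [|fuel IH] ds G Xs Zs xs.
  by case: ds => // _ _ _ _ _ /perm_size.
case/lastP: ds => [_ _ _ _ _ /perm_size //|ds d].
rewrite size_rcons ltnS => le_fuel inv sorted_D D_ge2 leavesG degsD.
have d_ge2 : 2 <= d by move: D_ge2; rewrite all_rcons => /andP[].
have takeE : take (size ds) (rcons ds d) = ds by rewrite -cats1 take_size_cat.
rewrite /= size_rcons last_rcons /= takeE ltnS.
(* [Mtree_rec] stops already at [size ds <= d], whereas stars wait for a vertex of degree [d] only
   up to [d.-1]; the case [size ds = d] is settled at the end. *)
have [le_d|lt_d] := leqP (size ds) d.-1.
  rewrite (leq_trans le_d) ?leq_pred // -cats1 in inv sorted_D D_ge2 degsD *.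
  have := better_take_stars inv sorted_D _ D_ge2 _ leavesG degsD.
  case: (take_stars ds [::] G) => Ss' G' [||ys [_ [better_ys leaves_ys degs_ys _]]] //.
    by rewrite addn0.
  apply: (better_trans better_ys); apply: isomorphic_better => //.
  by apply: unroot_perm; rewrite expand_leaves ?(perm_size degs_ys).
pose es := take d.-1 ds; pose es' := drop d.-1 ds.
have dsE : ds = es ++ es' by rewrite cat_take_drop.
have size_es : size es = d.-1 by rewrite size_takel // ltnW.
have es'_n0 : es' <> [::].
  by move=> /(congr1 size)/eqP; rewrite size_drop subn_eq0 leqNgt lt_d.
have take_es : take d.-1 (rcons ds d) = es by rewrite -cats1 takel_cat // ltnW.
rewrite take_es dsE rcons_cat in inv sorted_D D_ge2 degsD *.
have := better_take_stars inv sorted_D _ D_ge2 _ leavesG degsD.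
have := size_take_stars es [::] G; rewrite take_stars_cat.
case: (take_stars es [::] G) => Ss' G' /=; rewrite size_es addn0 => size_Ss' stars.
have {stars}[||ys [Zs' [better_ys leaves_ys degs_ys inv_ys]]] := stars.
- by case: (es').
- by rewrite last_rcons.
have sorted_es' : sorted geq (rcons es' d) by move: sorted_D => /cat_sorted2[].
have [|zs [better_zs leaves_zs degs_zs inv_zs]] :=
    better_star_bundle inv_ys sorted_es' es'_n0 size_Ss' _ leaves_ys degs_ys.
  exact: ltnW.
apply: (better_trans better_ys); apply: (better_trans better_zs).
rewrite -dsE; case: ifP => [le_ds|_]; last first.
  apply: IH inv_zs _ _ leaves_zs degs_zs.
  - by rewrite size_drop (leq_trans (leq_subr _ _)).
  - by move: sorted_es'; rewrite -cats1 => /cat_sorted2[].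
  - by move: D_ge2; rewrite all_cat all_rcons => /and3P[].
(* The case [size ds = d]: here [d.-1] stars have been bundled and a single degree [e] is left.
   Rerooting at the bundle shows the centre of degree [d] with [d] stars around it. *)
case: es' es'_n0 dsE degs_zs {inv inv_ys inv_zs degs_ys degsD sorted_es' sorted_D D_ge2}
  => [//|e [|e' es']] _ dsE degs_zs; last first.
  move: le_ds; rewrite dsE size_cat size_es /=.
  by move: (size es') d_ge2 => /= n; lia.
have /expand_leaves expE := perm_size degs_zs.
have size_G' : size G' = e.-1.
  have := perm_mem degs_zs (size zs); rewrite !inE eqxx => /esym/eqP <-.
  by rewrite -(size_map expand) expE (perm_size leaves_zs).
rewrite /= size_G' subnn drop0 take0 cats0.
apply: (@better_trans _ _ _ (Node (Node Ss' :: G'))).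
  by apply: isomorphic_better => //; apply: unroot_perm; rewrite expE.
by apply: isomorphic_better => //; apply: unroot_reroot.
Qed.

(** Before the first star, [bullet] serves as the last bundle and a star with [(head 0 ds).-1]
    leaves as the last star. *)
Lemma contraction_inv_bullets n ds : sorted geq ds ->
  contraction_inv (nseq n bullet) [::] ds [::] (nseq (head 0 ds).-1 bullet).
Proof.
move=> sorted_ds; split=> //.
- by rewrite map_nseq; elim: n => // -[|n] //= ->; rewrite lexx.
- by move=> T /nseqP[->].
- by move=> S T /nseqP[-> _] /nseqP[->].
- by move=> T /nseqP[->].
- exact: rho_mono.
case: ds sorted_ds => //= d ds; rewrite (path_sortedE geq_trans) => /andP[/allP ds_le _] e.
rewrite size_nseq inE => /orP[/eqP-> //|/ds_le le_e].
by rewrite -!subn1 leq_sub2r.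
Qed.

End Decreasing.

(** Bundling no branches at a vertex of degree 1 turns it into a leaf hiding [bullet]; this passes
    to the reduced degree sequence. *)
Lemma better_collapse_leaves (R : realType) (rho : rtree -> R) (I : tree -> R)
    (I_inv : tree_invariant I) (I_compat : max_compatible rho I) ds j k xs :
  ds <> [::] ->
  perm_eq (map snd (cleaves (CNode xs))) (nseq j bullet) ->
  perm_eq (croot_degs (CNode xs)) (ds ++ nseq k 1) ->
  exists ys, [/\ better I (expand (CNode xs)) (expand (CNode ys)),
    perm_eq (map snd (cleaves (CNode ys))) (nseq (k + j) bullet) &
    perm_eq (croot_degs (CNode ys)) ds].
Proof.
move=> ds_n0; elim: k j xs => [|k IH] j xs leaves_xs degs_xs.
  by exists xs; split=> //; rewrite cats0 in degs_xs.
have D_gt1 : 1 < size (ds ++ nseq k.+1 1).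
  by rewrite size_cat size_nseq; case: (ds) ds_n0 => //= *; rewrite addnS.
have D_gt0 : {in ds ++ nseq k.+1 1, forall e, 0 < e}.
  move=> e; rewrite -(perm_mem degs_xs); apply: croot_degs_gt0.
  by rewrite (perm_size degs_xs).
have d_in : 1 \in ds ++ nseq k.+1 1 by rewrite mem_cat mem_head orbT.
have gath : gatherable rho false [::] (nseq j bullet) (ds ++ nseq k.+1 1) 1 by split.
have [ys [better_ys leaves_ys degs_ys]] :=
  bundle I_inv I_compat gath isT d_in D_gt1 leaves_xs degs_xs.
have [||zs [better_zs leaves_zs degs_zs]] := IH j.+1 ys; first exact: leaves_ys.
  rewrite (permPl degs_ys) -(perm_cons 1) -(permPl (perm_to_rem d_in)).
  by rewrite perm_sym -cat1s perm_catCA.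
by exists zs; split; rewrite ?addSnnS //; apply: better_trans better_zs.
Qed.

(** * Filling the leaves of a rooted tree *)

Definition incomparable (p q : seq nat) : bool := ~~ prefix p q && ~~ prefix q p.

Lemma incomparable_sym : symmetric incomparable.
Proof. by move=> p q; rewrite /incomparable andbC. Qed.

Lemma incomparable_cat p q r : incomparable p q -> incomparable (p ++ r) q.
Proof.
move=> /andP[np nq]; apply/andP; split.
  by apply: contra np => /prefixP[s ->]; rewrite -catA prefix_prefix.
apply/prefixP => -[s E]; have [le_pq|lt_qp] := leqP (size p) (size q).
  case/negP: np; apply/prefixP; exists (drop (size p) q).
  rewrite -[LHS](cat_take_drop (size p)); congr cat.
  by rewrite -(takel_cat s le_pq) -E take_size_cat.
case/negP: nq; apply/prefixP; exists (drop (size q) p).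
rewrite -[LHS](cat_take_drop (size q)); congr cat.
by rewrite -(takel_cat r (ltnW lt_qp)) E take_size_cat.
Qed.

Lemma incomparable_rcons p i j : i != j -> incomparable (rcons p i) (rcons p j).
Proof.
move=> ij; have ji : j != i by rewrite eq_sym.
by rewrite /incomparable -!cats1 !prefix_catr // eqxx /= !andbT ij ji.
Qed.

Lemma set_nth_twice (T : Type) (x0 : T) s n x y :
  set_nth x0 (set_nth x0 s n x) n y = set_nth x0 s n y.
Proof. by rewrite set_set_nth eqxx. Qed.

Lemma replace_at_comm t p q S T : incomparable p q ->
  replace_at (replace_at t p S) q T = replace_at (replace_at t q T) p S.
Proof.
elim: p q t => [|i p IH] [|j q] t; rewrite /incomparable ?prefix0s ?andbF //.
rewrite !prefix_cons /=; have [<-|ij] /= := eqVneq i j.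
  by move=> inc; rewrite !nth_set_nth /= eqxx !set_nth_twice IH.
move=> _; have ji := negPf ij; rewrite eq_sym in ji.
rewrite !nth_set_nth /= (negPf ij) ji; congr Node.
by rewrite set_set_nth (negPf ij).
Qed.

Lemma replace_at_cat t p r S T :
  replace_at (replace_at t p S) (p ++ r) T = replace_at t p (replace_at S r T).
Proof.
elim: p t => //= i p IH t.
by rewrite nth_set_nth /= eqxx set_nth_twice IH.
Qed.

Lemma subtree_at_replace_at t p r S :
  subtree_at (replace_at t p S) (p ++ r) = subtree_at S r.
Proof. by elim: p t => //= i p IH t; rewrite nth_set_nth /= eqxx IH. Qed.

Fixpoint fill (t : rtree) (ps : seq (seq nat)) (ts : seq rtree) : rtree :=
  match ps, ts with
  | p :: ps', u :: ts' => fill (replace_at t p u) ps' ts'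
  | _, _ => t
  end.

Lemma fill_cat t ps qs ts us : size ps = size ts ->
  fill t (ps ++ qs) (ts ++ us) = fill (fill t ps ts) qs us.
Proof. by elim: ps t ts => [|p ps IH] t [|u ts] //= [/IH->]. Qed.

Lemma fill_replace_at t p S ps ts : all (incomparable p) ps ->
  fill (replace_at t p S) ps ts = replace_at (fill t ps ts) p S.
Proof.
elim: ps t ts => [|q ps IH] t [|u ts] //= /andP[pq p_ps].
by rewrite replace_at_comm // IH.
Qed.

Lemma fill_below t p S ps ts :
  fill (replace_at t p S) (map (cat p) ps) ts = replace_at t p (fill S ps ts).
Proof.
by elim: ps S ts => [|q ps IH] S [|u ts] //=; rewrite replace_at_cat IH.
Qed.

Lemma set_nth_size (T : Type) (x0 : T) us x y vs :
  set_nth x0 (us ++ x :: vs) (size us) y = us ++ y :: vs.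
Proof. by elim: us => //= u us ->. Qed.

Lemma fill_children us ts vs :
  fill (Node (us ++ nseq (size ts) bullet ++ vs))
       [seq [:: i] | i <- iota (size us) (size ts)] ts = Node (us ++ ts ++ vs).
Proof.
elim: ts us => //= t ts IH us; rewrite set_nth_size.
by rewrite -cat_rcons -(size_rcons us t) IH cat_rcons.
Qed.

Lemma fill_bullets ts :
  fill (Node (nseq (size ts) bullet)) [seq [:: i] | i <- iota 0 (size ts)] ts = Node ts.
Proof. by have := fill_children [::] ts [::]; rewrite !cats0. Qed.

(** * The greedy tree is built by contraction *)

(** The queue is the list of the contraction run backwards: [grow] removes the first address and
    appends those of its children, while [huffman_step] removes the last branches and puts their
    bundle in front. *)
Lemma grow_fill D t ps : all (predC1 [::]) ps -> pairwise incomparable ps ->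
  huffman_fits [::] D -> size (foldr huffman_step [::] D) = size ps ->
  grow t ps D = fill t ps (foldr huffman_step [::] D).
Proof.
elim: D t ps => [|d D IH] t ps /=; first by case: ps.
set L := foldr huffman_step [::] D.
case: ps => // p ps /= /andP[p_n0 ps_n0] /andP[p_ps ps_inc] /andP[fits size_L].
move=> [size_take_L]; rewrite (negPf p_n0).
have chE : [seq rcons p i | i <- iota 0 d.-1] =
           map (cat p) [seq [:: i] | i <- iota 0 d.-1].
  by rewrite -map_comp; apply: eq_map => i; rewrite /= cats1.
have size_drop_L : size (drop (size L - d.-1) L) = d.-1.
  by rewrite size_drop subKn.
rewrite {}IH //.
- rewrite -/L -[X in fill _ _ X](cat_take_drop (size L - d.-1)) fill_cat //.
  rewrite fill_replace_at // chE fill_below -[in nseq _ _]size_drop_L.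
  by rewrite -[in iota _ _]size_drop_L fill_bullets fill_replace_at.
- rewrite all_cat ps_n0 all_map; apply/allP => i _ /=.
  by rewrite -size_eq0 size_rcons.
- rewrite pairwise_cat ps_inc pairwise_map; apply/and3P; split=> //.
    rewrite chE; apply/allrelP => q _ q_in /mapP[r _ ->]; rewrite incomparable_sym.
    by apply: incomparable_cat; apply: (allP p_ps).
  have := iota_uniq 0 d.-1; rewrite uniq_pairwise; apply: sub_pairwise => i j /= ij.
  exact: incomparable_rcons.
by rewrite -/L size_cat size_map size_iota -size_take_L size_takel ?leq_subr ?subnK.
Qed.

Lemma greedy_tree_huffman d D :
  huffman_fits [::] D -> size (foldr huffman_step [::] D) = d ->
  greedy_tree (d :: D) = unroot (Node (foldr huffman_step [::] D)).
Proof.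
move=> fits sizeD; rewrite /greedy_tree /= grow_fill ?size_map ?size_iota //.
- by rewrite -sizeD fill_bullets.
- by rewrite all_map; apply/allP.
rewrite pairwise_map.
have := iota_uniq 0 d; rewrite uniq_pairwise; apply: sub_pairwise => i j /= ij.
exact: (incomparable_rcons [::]).
Qed.

(** * The M-tree is built by contraction *)

Lemma take_starsE ds Ss G (k := size G - sumn (map predn ds)) :
  sumn (map predn ds) <= size G ->
  take_stars ds Ss G =
  (map Node (reshape (map predn (rev ds)) (drop k G)) ++ Ss, take k G).
Proof.
rewrite {}/k; elim: ds Ss G => [|d ds IH] Ss G /= le_G.
  by rewrite subn0 take_size.
have le_d : d.-1 <= size G by apply: leq_trans le_G; apply: leq_addr.
set m := sumn _ in IH le_G *.
have kE : m + (size G - (d.-1 + m)) = size G - d.-1 by lia.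
have size_take_d : size (take (size G - d.-1) G) = size G - d.-1.
  by rewrite size_takel // leq_subr.
rewrite IH size_take_d; last by lia.
rewrite -subnDA take_takel; last by lia.
congr (_, _); rewrite rev_cons map_rcons.
have sumE : sumn (map predn (rev ds)) = m by rewrite map_rev sumn_rev.
rewrite reshape_rcons sumE; last by rewrite size_drop; lia.
by rewrite take_drop drop_drop kE map_rcons cat_rcons.
Qed.

Lemma subtree_at_rcons t p i :
  subtree_at t (rcons p i) = nth bullet (children (subtree_at t p)) i.
Proof. by rewrite -cats1 subtree_at_cat. Qed.

Lemma size_children_replace_at t s S u :
  s \in addresses t -> u \in addresses t -> ~~ prefix s u ->
  size (children (subtree_at (replace_at t s S) u)) =
  size (children (subtree_at t u)).
Proof.
elim: s t u => [|i s IH] t [|j u] //=.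
  rewrite cons_addresses => /andP[i_lt _] _ _.
  by rewrite size_set_nth (maxn_idPr i_lt).
rewrite !cons_addresses => /andP[i_lt s_in] /andP[j_lt u_in].
rewrite nth_set_nth /= eq_sym.
by case: (eqVneq i j) u_in => [<-|//] u_in /=; apply: IH.
Qed.

Lemma replace_at_bullet t s :
  s \in addresses t -> subtree_at t s = bullet -> replace_at t s bullet = t.
Proof.
elim: s t => [|i s IH] [ts] //=; rewrite addresses_nth => /andP[i_lt s_in] s_leaf.
rewrite IH //; congr Node; apply: (@eq_from_nth _ bullet).
  by rewrite size_set_nth (maxn_idPr i_lt).
by move=> j _; rewrite nth_set_nth /=; case: eqP => [->|].
Qed.

Lemma addresses_subtree_at t p : children (subtree_at t p) <> [::] -> p \in addresses t.
Proof.
elim: p t => [|i p IH] t; first by rewrite nil_addresses.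
rewrite cons_addresses /=; have [i_lt|le_i] := ltnP i (size (children t)).
  by move=> /IH->.
rewrite nth_default //; have -> : subtree_at bullet p = bullet; last by [].
by elim: p {IH} => // j p /= IH; rewrite nth_nil.
Qed.

(* The leaves next to the labelled vertices, in the order of the labels. *)
Definition leaf_children (t : rtree) (p : seq nat) : seq nat :=
  [seq i <- iota 0 (size (children (subtree_at t p)))
   | nilp (children (subtree_at t (rcons p i)))].

Definition slots (t : rtree) (labels : seq (seq nat)) : seq (seq nat) :=
  [seq rcons p i | p <- labels, i <- leaf_children t p].

Lemma slotsP t labels s : reflect
  (exists p i, [/\ p \in labels, s = rcons p i, s \in addresses t
                & subtree_at t s = bullet]) 
  (s \in slots t labels).
Proof.
apply: (iffP allpairsPdep) => [[p [i [p_in]]]|[p [i [p_in -> s_in s_leaf]]]].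
  rewrite mem_filter mem_iota add0n => /= /andP[leaf_i i_lt] sE.
  have p_addr : p \in addresses t.
    by apply: addresses_subtree_at => ch0; rewrite ch0 in i_lt.
  exists p, i; rewrite sE rcons_addresses p_addr; split=> //.
  by move: leaf_i; case: (subtree_at _ _) => -[].
exists p, i; split=> //; rewrite mem_filter s_leaf mem_iota add0n.
by move: s_in; rewrite rcons_addresses => /andP[].
Qed.

Definition labelled (t : rtree) (labels : seq (seq nat)) : Prop :=
  uniq labels /\ {in labels, forall p, children (subtree_at t p) <> [::]}.

Lemma uniq_slots t labels : uniq labels -> uniq (slots t labels).
Proof.
move=> labels_uniq; apply: allpairs_uniq_dep => //.
  by move=> p _; rewrite filter_uniq ?iota_uniq.
by move=> [p i] [q j] _ _ /= /rcons_inj[-> ->].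
Qed.

Lemma subtree_at_bullet p : subtree_at bullet p = bullet.
Proof. by elim: p => // j p /= IH; rewrite nth_nil. Qed.

(** A slot properly below another would have its parent, a labelled vertex with children, at or
    below a leaf. *)
Lemma incomparable_slots t labels : labelled t labels ->
  {in slots t labels &, forall s s', s != s' -> incomparable s s'}.
Proof.
move=> [_ labelsP].
suff no_prefix s s' : s \in slots t labels -> s' \in slots t labels -> s != s' ->
    ~~ prefix s s'.
  by move=> s s' s_in s'_in ss'; rewrite /incomparable !no_prefix // eq_sym.
move=> /slotsP[p [i [p_in -> _ s_leaf]]] /slotsP[q [j [q_in -> _ _]]] ss'.
apply/prefixP => -[r]; case/lastP: r => [|r l].
  by rewrite cats0 => E; rewrite E eqxx in ss'.
rewrite -rcons_cat => /rcons_inj[qE _]; apply: (labelsP _ q_in).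
by rewrite qE subtree_at_cat s_leaf subtree_at_bullet.
Qed.

Lemma pairwise_incomparable_slots t labels :
  labelled t labels -> pairwise incomparable (slots t labels).
Proof.
move=> lab; have inc := incomparable_slots lab.
have := uniq_slots t lab.1; move: inc; elim: (slots t labels) => //= s q IH inc.
move=> /andP[s_q q_uniq]; rewrite IH // ?andbT; last first.
  by move=> x y x_in y_in; apply: inc; rewrite inE ?x_in ?y_in orbT.
apply/allP => r r_in; apply: inc; rewrite ?mem_head ?inE ?r_in ?orbT //.
by apply: contra s_q => /eqP->.
Qed.

Lemma fill_slots_bullets t labels :
  fill t (slots t labels) (nseq (size (slots t labels)) bullet) = t.
Proof.
have : {in slots t labels, forall s,
    s \in addresses t /\ subtree_at t s = bullet}.
  by move=> s /slotsP[p [i []]].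
elim: (slots t labels) => //= s q IH all_q.
have [s_in s_leaf] := all_q s (mem_head _ _).
rewrite replace_at_bullet // IH // => r r_in.
by apply: all_q; rewrite inE r_in orbT.
Qed.

(** The root of [S] is unlabelled, so its children are no slots; [s] itself ceases to be a leaf. *)
Lemma slots_replace_at t labels s S : labelled t labels ->
  s \in slots t labels -> children S <> [::] ->
  slots (replace_at t s S) labels = [seq r <- slots t labels | r != s].
Proof.
move=> lab /slotsP[p0 [i0 [_ _ s_in s_leaf]]] S_node.
have [_ labelsP] := lab.
have below u : u \in addresses t -> prefix s u -> u = s.
  move=> u_in /prefixP[r uE]; move: u_in.
  rewrite uE mem_addresses_cat // s_leaf inE => /eqP->.
  by rewrite cats0.
have size_ch u : u \in addresses t -> u != s ->
    size (children (subtree_at (replace_at t s S) u)) = size (children (subtree_at t u)).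
  move=> u_in us; apply: size_children_replace_at => //.
  by apply: contra us => /(below u u_in)->.
rewrite /slots filter_flatten -map_comp; congr flatten; apply/eq_in_map => p p_in /=.
have p_addr := addresses_subtree_at (labelsP p p_in).
have ps : p != s by apply/eqP => E; apply: (labelsP p p_in); rewrite E s_leaf.
rewrite filter_map; congr map; rewrite /leaf_children size_ch // -filter_predI.
apply/eq_in_filter => i; rewrite mem_iota add0n => /= i_lt.
have u_in : rcons p i \in addresses t by rewrite rcons_addresses p_addr.
have [->|us] := eqVneq (rcons p i) s; last by rewrite /nilp size_ch.
rewrite -[s in subtree_at (replace_at _ _ _) s]cats0 subtree_at_replace_at /=.
by case: (children S) S_node.
Qed.

Fixpoint star_slots (k : nat) (es : seq nat) : seq (seq nat) :=
  if es is e :: es' then [seq [:: k; j] | j <- iota 0 e.-1] ++ star_slots k.+1 es'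
  else [::].

Lemma size_star_slots k es : size (star_slots k es) = sumn (map predn es).
Proof. by elim: es k => //= e es IH k; rewrite size_cat size_map size_iota IH. Qed.

Lemma fill_star us vs G :
  fill (Node (us ++ star (size G).+1 :: vs))
       [seq [:: size us; j] | j <- iota 0 (size G)] G = Node (us ++ Node G :: vs).
Proof.
have -> : Node (us ++ star (size G).+1 :: vs) =
          replace_at (Node (us ++ bullet :: vs)) [:: size us] (star (size G).+1).
  by rewrite /= set_nth_size.
have -> : [seq [:: size us; j] | j <- iota 0 (size G)] =
          map (cat [:: size us]) [seq [:: j] | j <- iota 0 (size G)].
  by rewrite -map_comp.
by rewrite fill_below fill_bullets /= set_nth_size.
Qed.

Lemma fill_stars us es vs G : all (leq 2) es -> size G = sumn (map predn es) ->
  fill (Node (us ++ map star es ++ vs)) (star_slots (size us) es) G =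
  Node (us ++ map Node (reshape (map predn es) G) ++ vs).
Proof.
elim: es us G => [|e es IH] us G; first by case: G.
move=> /andP[e_ge2 es_ge2] /= size_G.
have size_take_G : size (take e.-1 G) = e.-1 by rewrite size_takel // size_G leq_addr.
rewrite -[X in fill _ _ X](cat_take_drop e.-1) fill_cat; last first.
  by rewrite size_map size_iota.
have := fill_star us (map star es ++ vs) (take e.-1 G).
rewrite size_take_G prednK => [->|]; last exact: ltnW.
rewrite -!cat_rcons -(size_rcons us (Node (take e.-1 G))) IH //.
by rewrite size_drop size_G addKn.
Qed.

Lemma slots_stars t s k es :
  (forall j, j < size es -> subtree_at t (s ++ [:: k + j]) = star (nth 0 es j)) ->
  slots t [seq s ++ [:: i] | i <- iota k (size es)] = map (cat s) (star_slots k es).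
Proof.
elim: es k => //= e es IH k tP.
rewrite map_cat -IH => [|j j_lt]; last by rewrite addSnnS; apply: (tP j.+1).
congr cat; have := tP 0 isT; rewrite addn0 => sE.
rewrite /leaf_children sE size_nseq -map_comp.
rewrite (_ : filter _ _ = iota 0 e.-1); last first.
  apply/all_filterP/allP => i _ /=.
  by rewrite subtree_at_rcons sE nth_nseq; case: ifP.
by apply: eq_map => i /=; rewrite -cats1 -catA.
Qed.

Lemma labelled_base es n : all (leq 2) es -> 0 < size es + n ->
  labelled (Node (map star es ++ nseq n bullet))
           ([::] :: [seq [:: i] | i <- iota 0 (size es)]).
Proof.
move=> es_ge2 n_gt0; split.
  rewrite /= map_inj_uniq ?iota_uniq ?andbT => [|i j [] //].
  by apply/mapP => -[].
move=> p; rewrite inE => /orP[/eqP-> /(congr1 size)|].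
  by rewrite size_cat size_map size_nseq => E; rewrite E in n_gt0.
case/mapP => i; rewrite mem_iota add0n => /andP[_ i_lt] -> /=.
rewrite nth_cat size_map i_lt (nth_map 0) //.
by move: (all_nthP 0 es_ge2 i i_lt); case: (nth 0 es i) => [|[]].
Qed.

Lemma slots_base es n : all (leq 2) es ->
  slots (Node (map star es ++ nseq n bullet))
        ([::] :: [seq [:: i] | i <- iota 0 (size es)]) =
  [seq [:: i] | i <- iota (size es) n] ++ star_slots 0 es.
Proof.
move=> es_ge2.
have slotsE : star_slots 0 es = map (cat [::]) (star_slots 0 es) by rewrite map_id_in.
rewrite [in RHS]slotsE.
rewrite -(@slots_stars (Node (map star es ++ nseq n bullet))) => [|j j_lt]; last first.
  by rewrite /= nth_cat size_map j_lt (nth_map 0).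
congr cat; rewrite -[RHS]/(map (rcons [::]) (iota (size es) n)); congr map.
rewrite /leaf_children size_cat size_map size_nseq iotaD filter_cat add0n.
set P := fun i => _.
have -> : filter P (iota 0 (size es)) = [::].
  apply/eqP; rewrite -size_eq0 size_filter -leqn0 leqNgt -has_count; apply/hasPn.
  move=> i; rewrite mem_iota add0n => /andP[_ i_lt]; rewrite /P /=.
  rewrite nth_cat size_map i_lt (nth_map 0) //.
  by move: (all_nthP 0 es_ge2 i i_lt); case: (nth 0 es i) => [|[]].
apply/all_filterP/allP => i; rewrite mem_iota => /andP[le_i i_lt]; rewrite /P /=.
by rewrite nth_cat size_map ltnNge le_i nth_nseq; case: ifP.
Qed.

Lemma Mtree_baseP ds (t := size ds) (d := last 0 ds) (es := rev (take t.-1 ds))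
    (T := Node (map star es ++ nseq (d - t.-1) bullet))
    (labels := [::] :: [seq [:: i] | i <- iota 0 t.-1]) :
  ds <> [::] -> all (leq 2) ds -> t <= d.+1 ->
  [/\ labelled T labels, size (slots T labels) + (size ds).*2 = sumn ds + 2 &
     forall G, size G = size (slots T labels) -> fill T (slots T labels) G =
       let: (Ss, G') := take_stars (take t.-1 ds) [::] G in Node (Ss ++ G')].
Proof.
rewrite {}/T {}/labels {}/es {}/t {}/d.
case/lastP: ds => // ds d _; rewrite all_rcons => /andP[d_ge2 ds_ge2].
rewrite last_rcons size_rcons /= ltnS -cats1 take_size_cat // cats1 => le_d.
have es_ge2 : all (leq 2) (rev ds) by rewrite all_rev.
have sumE : sumn (map predn (rev ds)) = sumn (map predn ds) by rewrite map_rev sumn_rev.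
have sumE' : sumn (map predn ds) + size ds = sumn ds.
  by elim: (ds) ds_ge2 => //= e es IH /andP[e_ge2 /IH]; lia.
rewrite -(size_rev ds) slots_base //.
have size_q : size ([seq [:: i] | i <- iota (size (rev ds)) (d - size (rev ds))] ++
                    star_slots 0 (rev ds)) = d - size ds + sumn (map predn ds).
  by rewrite size_cat size_map size_iota size_star_slots sumE size_rev.
split.
- by apply: labelled_base => //; rewrite size_rev subnKC // ltnW.
- by rewrite size_q sumn_rcons size_rev; lia.
move=> G; rewrite size_q => size_G.
rewrite take_starsE; last by rewrite size_G leq_addl.
rewrite size_G addnK cats0.
have size_take_G : size (take (d - size ds) G) = d - size ds.
  by rewrite size_takel // size_G leq_addr.
rewrite -[X in fill _ _ X](cat_take_drop (d - size ds)) fill_cat; last first.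
  by rewrite size_map size_iota size_rev.
have := fill_children (map star (rev ds)) (take (d - size ds) G) [::].
rewrite size_take_G size_map !cats0 size_rev => ->.
rewrite (fill_stars [::]) // size_drop size_G sumE addKn //.
Qed.

(** [mcontract] puts the bundle of stars at the head of its list, so it must go into the first slot,
    which is where [Mtree_rec] attaches it. *)
Lemma slots_head t labels (leaf_node := fun S => nilp (children S))
    (vs := nth [::] labels
      (find (fun p => has leaf_node (children (subtree_at t p))) labels))
    (i0 := find leaf_node (children (subtree_at t vs))) :
  slots t labels <> [::] -> slots t labels = rcons vs i0 :: behead (slots t labels).
Proof.
rewrite {}/i0 {}/vs; elim: labels => //= p labels IH.
have -> : slots t (p :: labels) = map (rcons p) (leaf_children t p) ++ slots t labels.
  by [].
have leafE : leaf_children t p = [seq i <- iota 0 (size (children (subtree_at t p))) |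
    leaf_node (nth bullet (children (subtree_at t p)) i)].
  by apply: eq_filter => i; rewrite subtree_at_rcons.
have [p_leaf|p_leaf] := ifP.
  move=> _; rewrite leafE [nth _ _ _]/=; set ch := children _ in p_leaf *.
  have i_lt : find leaf_node ch < size ch by rewrite -has_find.
  have -> : size ch = find leaf_node ch + (size ch - find leaf_node ch).-1.+1 by lia.
  rewrite iotaD filter_cat add0n /= nth_find //.
  rewrite (_ : filter _ (iota 0 _) = [::]) //.
  apply/eqP; rewrite -size_eq0 size_filter -leqn0 leqNgt -has_count; apply/hasPn.
  by move=> i; rewrite mem_iota add0n => /andP[_ /(before_find bullet)->].
suff -> : leaf_children t p = [::] by [].
apply/eqP; rewrite -size_eq0 leafE size_filter -leqn0 leqNgt -has_count; apply/hasPn.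
move=> i; rewrite mem_iota add0n => /andP[_ i_lt].
apply/negP => i_leaf; move/hasP: p_leaf; apply.
by exists (nth bullet (children (subtree_at t p)) i); rewrite ?mem_nth.
Qed.

(** Slots and contracted branches correspond in order. The count, which agrees with the handshake
    lemma, shows that a free slot exists at every recursive call. *)
Lemma Mtree_recP fuel ds (T := (Mtree_rec fuel ds).1) (labels := (Mtree_rec fuel ds).2) :
  size ds <= fuel -> ds <> [::] -> all (leq 2) ds ->
  [/\ labelled T labels, size (slots T labels) + (size ds).*2 = sumn ds + 2 &
     forall G, size G = size (slots T labels) ->
       fill T (slots T labels) G = mcontract fuel ds G].
Proof.
rewrite {}/T {}/labels; elim: fuel ds => [|fuel IH] ds; first by case: ds.
rewrite [Mtree_rec _ _]/= [mcontract _ _]/=.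
have [le_t le_fuel ds_n0 ds_ge2|] := leqP (size ds) (last 0 ds).+1.
  exact: Mtree_baseP.
case/lastP: ds => // ds d; rewrite size_rcons last_rcons ltnS /= => lt_t le_fuel _.
rewrite all_rcons => /andP[d_ge2 ds_ge2].
have -> : take (size ds) (rcons ds d) = ds by rewrite -cats1 take_size_cat.
have le_d : d.-1 <= size ds by lia.
have -> : take d.-1 (rcons ds d) = take d.-1 ds by rewrite -cats1 takel_cat.
set ds' := drop d.-1 ds; set es := rev (take d.-1 ds).
have size_es : size es = d.-1 by rewrite size_rev size_takel.
have es_ge2 : all (leq 2) es.
  by rewrite all_rev; apply/allP => e /mem_take/(allP ds_ge2).
have ds'_ge2 : all (leq 2) ds' by apply/allP => e /mem_drop/(allP ds_ge2).
have size_ds' : size ds' = size ds - d.-1 by rewrite size_drop.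
have [||//|] := IH ds'; first by rewrite size_ds' (leq_trans (leq_subr _ _)).
  by move=> /(congr1 size); rewrite size_ds' /=; lia.
case: (Mtree_rec fuel ds') => T labels /= lab size_q fillT.
have q_n0 : slots T labels <> [::].
  move=> q0; move: size_q; rewrite q0.
  have := double_size_le_sumn ds'_ge2; rewrite /=; lia.
have := slots_head q_n0; set vs := nth _ _ _; set i0 := find _ _.
set s := rcons vs i0; set q := behead _ => qE.
set Rd := Node [seq star e | e <- es].
have Rd_node : children Rd <> [::].
  by move=> /(congr1 size); rewrite size_map size_es; move: (d) d_ge2 => [|[]].
have s_in : s \in slots T labels by rewrite qE mem_head.
have s_q : s \notin q by have := uniq_slots T lab.1; rewrite qE => /andP[].
have qE' : [seq r <- slots T labels | r != s] = q.
  rewrite qE /= eqxx /=; apply/all_filterP/allP => r r_q.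
  by apply: contra s_q => /eqP <-.
have /slotsP[_ [_ [_ _ s_addr s_leaf]]] := s_in.
set T' := replace_at T s Rd.
set news := [seq vs ++ [:: i0; i] | i <- iota 0 d.-1].
have newsE : news = [seq s ++ [:: i] | i <- iota 0 (size es)].
  by rewrite /news size_es; apply: eq_map => i; rewrite cat_rcons.
have starP j : j < size es -> subtree_at T' (s ++ [:: j]) = star (nth 0 es j).
  by move=> j_lt; rewrite subtree_at_replace_at /= (nth_map 0).
(* The slot [s] is used up, and the leaves of the new stars come last: [take_stars] takes its
   branches from the end of [G]. *)
have slotsE : slots T' (labels ++ news) = q ++ map (cat s) (star_slots 0 es).
  rewrite {1}/slots map_cat flatten_cat -/(slots T' labels) -/(slots T' news).
  rewrite slots_replace_at // qE' newsE; congr cat.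
  by apply: slots_stars => j j_lt; rewrite add0n starP.
have sumE : sumn (map predn es) + size es = sumn es.
  by elim: (es) es_ge2 => //= e es' IHes /andP[e_ge2 /IHes]; lia.
have sum_ds : sumn ds = sumn es + sumn ds'.
  by rewrite sumn_rev -sumn_cat cat_take_drop.
have below_new p : p \in labels -> p \notin news.
  move=> p_in; apply/negP; rewrite newsE => /mapP[i _ pE].
  by apply: (lab.2 p p_in); rewrite pE subtree_at_cat s_leaf subtree_at_bullet.
split.
- split.
    rewrite cat_uniq lab.1 newsE map_inj_uniq ?iota_uniq ?andbT; last first.
      by move=> i j /eqP; rewrite eqseq_cat // eqxx => /eqP[].
    by apply/hasPn => p; rewrite -newsE; apply: contraL => /below_new.
  move=> p; rewrite mem_cat => /orP[p_in|].
    have p_addr := addresses_subtree_at (lab.2 p p_in).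
    move=> /(congr1 size)/eqP; rewrite size_children_replace_at //; last first.
      apply/prefixP => -[r pE]; apply: (lab.2 p p_in).
      by rewrite pE subtree_at_cat s_leaf subtree_at_bullet.
    by rewrite size_eq0 => /eqP; apply: lab.2.
  rewrite newsE => /mapP[i]; rewrite mem_iota add0n => /andP[_ i_lt] ->.
  rewrite starP //.
  by move: (all_nthP 0 es_ge2 i i_lt); case: (nth 0 es i) => [|[]].
- rewrite slotsE size_cat size_map size_star_slots.
  move: size_q; rewrite qE /= sumn_rcons sum_ds size_ds'.
  by move: (size q) (sumn ds') sumE; rewrite size_es => /=; lia.
move=> G; rewrite slotsE size_cat size_map size_star_slots => size_G.
have sumE' : sumn (map predn (take d.-1 ds)) = sumn (map predn es).
  by rewrite map_rev sumn_rev.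
rewrite take_starsE sumE' ?size_G ?leq_addl // addnK cats0 -/es.
have size_take_G : size (take (size q) G) = size q by rewrite size_takel // size_G leq_addr.
rewrite -fillT; last by rewrite qE /= size_take_G.
rewrite -[X in fill _ _ X](cat_take_drop (size q)) fill_cat //.
have inc_q : all (incomparable s) q.
  by have := pairwise_incomparable_slots lab; rewrite qE => /andP[].
rewrite qE /= /T' (fill_replace_at T Rd _ inc_q) fill_below (fill_replace_at _ _ _ inc_q).
congr replace_at; have := @fill_stars [::] es [::] (drop (size q) G) es_ge2.
rewrite !cats0 => -> //.
by rewrite size_drop size_G addKn.
Qed.

Lemma Mtree_mcontract D k (ds := reduced D) :
  ds <> [::] -> k + (size ds).*2 = sumn ds + 2 ->
  Mtree D = unroot (mcontract (size ds) ds (nseq k bullet)).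
Proof.
move=> ds_n0 k_ds; rewrite /Mtree -/ds.
have ds_ge2 : all (leq 2) ds by rewrite filter_all.
have [lab size_q fillE] := Mtree_recP (leqnn _) ds_n0 ds_ge2.
rewrite -fillE; last by rewrite size_nseq; lia.
have -> : k = size (slots (Mtree_rec (size ds) ds).1 (Mtree_rec (size ds) ds).2) by lia.
by rewrite fill_slots_bullets; case: (ds) ds_n0.
Qed.

(** * Majorisation *)

(* [excess s] is convex in the threshold, and [B] majorises [D] exactly when
   [excess D <= excess B] with equality at 0 and [size D = size B]. *)
Definition excess (s : seq nat) (c : nat) : nat := sumn [seq x - c | x <- s].

Lemma excessS s c : excess s c = excess s c.+1 + count (ltn c) s.
Proof. by elim: s => //= x s; rewrite /excess /= => ->; case: (ltnP c x); lia. Qed.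

Lemma excess_cat s1 s2 c : excess (s1 ++ s2) c = excess s1 c + excess s2 c.
Proof. by rewrite /excess map_cat sumn_cat. Qed.

Lemma perm_excess s1 s2 c : perm_eq s1 s2 -> excess s1 c = excess s2 c.
Proof. by move=> eq_s; apply/perm_sumn/perm_map. Qed.

Lemma excess0 s : excess s 0 = sumn s.
Proof. by rewrite /excess (eq_map (g := id)) ?map_id // => x; rewrite subn0. Qed.

Lemma excess_large s c : sumn s <= c -> excess s c = 0.
Proof. by elim: s => //= x s IH; rewrite /excess /= -/(excess s c); lia. Qed.

Lemma excess_sumn s c : sumn s <= excess s c + size s * c.
Proof. by elim: s => //= x s; rewrite /excess /=; lia. Qed.

(** With [k] the number of entries of [D] above [c], the excess of [D] is its [k]-th partial sum
    minus [k * c], while that of [B] is at least the corresponding difference. *)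
Lemma majorises_excess B D : sorted geq D -> majorises B D ->
  forall c, excess D c <= excess B c.
Proof.
move=> sorted_D [size_BD sum_BD le_take] c.
have {}le_take k : k <= size D -> sumn (take k D) <= sumn (take k B).
  case: k => [|k]; first by rewrite !take0.
  rewrite leq_eqVlt => /orP[/eqP kE|k_lt]; last by apply: le_take; rewrite size_BD.
  by rewrite kE take_size -size_BD take_size sum_BD.
pose k := find (fun x => x <= c) D.
have k_le : k <= size D by apply: find_size.
have takeE : excess (take k D) c + k * c = sumn (take k D).
  have : all (fun x => c < x) (take k D).
    apply/(all_nthP 0) => i; rewrite size_takel // => i_lt; rewrite nth_take //.
    by rewrite ltnNge (before_find 0 i_lt).
  rewrite -[X in X * c](size_takel k_le); elim: (take k D) => //= x s IH.
  by rewrite /excess /= => /andP[lt_cx /IH]; rewrite /excess; lia.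
have dropE : excess (drop k D) c = 0.
  have : all (fun x => x <= c) (drop k D).
    have [k_lt|] := ltnP k (size D); last by move=> /drop_oversize->.
    have k_le_c : nth 0 D k <= c.
      by apply: (nth_find 0 (a := fun x => x <= c)); rewrite has_find.
    have := drop_sorted k sorted_D; rewrite (drop_nth 0 k_lt) /= (path_sortedE geq_trans).
    rewrite k_le_c => /andP[/allP le_k _]; apply/allP => x /le_k /= le_x.
    exact: leq_trans le_x k_le_c.
  elim: (drop k D) => //= x s IH /andP[le_xc /IH]; rewrite /excess /=.
  by move/eqP: le_xc => ->.
have := excess_sumn (take k B) c; have := le_take k k_le.
rewrite -[in excess D c](cat_take_drop k D) -[in excess B c](cat_take_drop k B).
by rewrite !excess_cat dropE addn0 size_takel ?size_BD //; lia.
Qed.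

(** The slopes of the excess count the entries above each threshold and so determine all
    multiplicities of positive entries. *)
Lemma excess_perm B D : all (ltn 0) B -> all (ltn 0) D ->
  (forall c, excess D c = excess B c) -> perm_eq D B.
Proof.
move=> B_gt0 D_gt0 eq_ex; have eq_count c : count (ltn c) D = count (ltn c) B.
  by have := eq_ex c; rewrite (excessS D c) (excessS B c) eq_ex => /addnI.
have count1 s c : count (ltn c) s = count_mem c.+1 s + count (ltn c.+1) s.
  by elim: s => //= x s ->; case: (ltngtP c.+1 x) => [|/ltnSE|]; lia.
apply/allP => -[|x] _ /=; last first.
  by apply/eqP; have := eq_count x; rewrite (count1 D) (count1 B) eq_count => /addIn.
have no0 s : all (ltn 0) s -> count_mem 0 s = 0.
  by elim: s => //= x s IH /andP[]; case: x => //= x _ /IH.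
by rewrite !no0.
Qed.

(* The window [p, q] is a maximal interval on which the excess of [D] is too
   small; the slopes at its ends show that two elements of [D] lie inside. *)
Lemma excess_window B D : (forall c, excess D c <= excess B c) ->
  excess D 0 = excess B 0 -> excess D 1 = excess B 1 ->
  (forall c, excess D c = excess B c) \/
  exists a b D', [/\ perm_eq D (a :: b :: D'), 2 <= b <= a &
     forall c, b <= c <= a -> excess D c < excess B c].
Proof.
move=> le_ex eq0 eq1.
have [[c0 lt0]|no_lt] := pselect (exists c, excess D c < excess B c); last first.
  left=> c; apply/eqP; rewrite eqn_leq le_ex leqNgt; apply/negP => lt_c.
  by apply: no_lt; exists c.
right; pose P p := (p <= c0) && (excess D p == excess B p).
have [p /andP[p_le /eqP eq_p] p_max] : exists2 p, P p & forall p', P p' -> p' <= p.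
  have exP : exists p, P p by exists 0; rewrite /P eq0 eqxx.
  have P_le p : P p -> p <= c0 by case/andP.
  by case: (ex_maxnP exP P_le) => p; exists p.
(* The excesses also agree at 1, so all elements inside the window are at least 2. *)
have p_ge1 : 1 <= p.
  apply: p_max; rewrite /P eq1 eqxx andbT lt0n; apply/eqP => c0E.
  by rewrite c0E eq0 ltnn in lt0.
pose Q q := (c0 <= q) && (excess D q == excess B q).
have [q /andP[q_ge /eqP eq_q] q_min] : exists2 q, Q q & forall q', Q q' -> q <= q'.
  have exQ : exists q, Q q.
    exists (c0 + (sumn D + sumn B)); rewrite /Q leq_addr /=.
    by rewrite !excess_large //; lia.
  by case: (ex_minnP exQ) => q; exists q.
have lt_window c : p < c < q -> excess D c < excess B c.
  move=> /andP[lt_pc lt_cq]; rewrite ltn_neqAle le_ex andbT; apply/negP => /eqP eq_c.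
  have [le_c|/ltnW le_c] := leqP c c0.
    by have := p_max c; rewrite /P le_c eq_c eqxx leqNgt lt_pc => /(_ isT).
  by have := q_min c; rewrite /Q le_c eq_c eqxx leqNgt lt_cq => /(_ isT).
have lt_pc0 : p < c0.
  rewrite ltn_neqAle p_le andbT; apply/eqP => pE.
  by rewrite -pE eq_p ltnn in lt0.
have lt_c0q : c0 < q.
  rewrite ltn_neqAle q_ge andbT; apply/eqP => qE.
  by rewrite qE eq_q ltnn in lt0.
have lt_Sp : excess D p.+1 < excess B p.+1 by apply: lt_window; lia.
have lt_Pq : excess D q.-1 < excess B q.-1 by apply: lt_window; lia.
(* [D] has more entries above [p] than [B], but fewer entries that are at least [q]; the difference
   is at least two. *)
have many : 2 <= count (fun x => p < x < q) D.
  have count_split s :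
      count (ltn p) s = count (fun x => p < x < q) s + count (ltn q.-1) s.
    by elim: s => //= x s ->; case: (ltnP p x); case: (ltnP q.-1 x); case: (ltnP x q); lia.
  have le_B : count (ltn q.-1) B <= count (ltn p) B by rewrite (count_split B) leq_addl.
  have := excessS D p; have := excessS B p; have := excessS D q.-1; have := excessS B q.-1.
  by rewrite prednK ?eq_p ?eq_q; have := count_split D; lia.
have permD : perm_eq ([seq x <- D | p < x < q] ++ [seq x <- D | ~~ (p < x < q)]) D.
  by rewrite perm_filterC.
move: many; rewrite -size_filter.
case F: [seq x <- D | p < x < q] permD => [|x [|y s]] //= permD _.
have x_in : p < x < q.
  by have := mem_head x (y :: s); rewrite -F mem_filter => /andP[].
have y_in : p < y < q.
  have : y \in x :: y :: s by rewrite !inE eqxx orbT.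
  by rewrite -F mem_filter => /andP[].
have {F}permD : perm_eq D (x :: y :: s ++ [seq x <- D | ~~ (p < x < q)]).
  by rewrite perm_sym.
have [le_yx|/ltnW le_xy] := leqP y x.
  by exists x, y, (s ++ [seq x <- D | ~~ (p < x < q)]); split=> // [|c c_in];
    [|apply: lt_window]; lia.
exists y, x, (s ++ [seq x <- D | ~~ (p < x < q)]); split=> [||c c_in].
- by rewrite (permPl permD) perm_cons2.
- by lia.
by apply: lt_window; lia.
Qed.

(** * Unit transfers between two degrees *)

Section Transfer.
Context {R : realType} (rho : rtree -> R) (I : tree -> R).
Hypothesis I_inv : tree_invariant I.
Hypothesis I_compat : max_compatible rho I.

Lemma transfer_degree t a b D :
  perm_eq (root_degs t) (a :: b :: D) -> 2 <= b <= a ->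
  exists u, (I (unroot t) <= I (unroot u))%R /\
            perm_eq (root_degs u) (a.+1 :: b.-1 :: D).
Proof.
move=> degs_t /andP[b_ge2 le_ba]; have [expE leavesE degsE] := uncontractedP t.
case: (uncontracted t) expE leavesE degsE => [? ? //|xs] expE leavesE degsE.
have a_in : a \in croot_degs (CNode xs) by rewrite degsE (perm_mem degs_t) mem_head.
have [ys [better_ys size_ys]] := reroot_degree I_inv a_in.
have [_ leaves_ys degs_ys] := better_ys.
have b_in : b \in flatten (map cbranch_degs ys).
  have : perm_eq (a :: b :: D) (size ys :: flatten (map cbranch_degs ys)).
    by rewrite -(permPr degs_ys) degsE perm_sym.
  by rewrite size_ys perm_cons => /perm_mem <-; rewrite mem_head.
have /flattenP[_ /mapP[y y_in ->]] := b_in; rewrite mem_cbranch_degs.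
case/(expose_node I_inv) => c [Ls [/eqP size_Ls LsP]].
set Rs := rem y ys in LsP.
have {better_ys}better_ys : cbetter I (CNode xs) (CNode (cplug c (CNode Ls) :: Rs)).
  apply: cbetter_trans better_ys _; apply: cbetter_trans (LsP _).
  exact/cbetter_perm/perm_to_rem.
have size_Rs : size Rs = a.-1 by rewrite size_rem // size_ys.
pose ge x y := (rho (expand y) <= rho (expand x))%R.
have ge_total : total ge by move=> x z; rewrite /ge le_total.
pose tot := sort ge (Rs ++ Ls).
have size_tot : size tot = a.-1 + b.-1 by rewrite size_sort size_cat size_Rs -size_Ls.
(* Besides the chain, the two ends carry [a.-1] and [b.-1] branches; [a] and [b.-2] branches make
   their degrees [a.+1] and [b.-1]. *)
pose top := take a tot; pose bot := drop a tot.
have size_top : size top = a by rewrite size_takel // size_tot; lia.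
have size_bot : size bot = b.-2 by rewrite size_drop size_tot; lia.
have perm_tb : perm_eq (Rs ++ Ls) (top ++ bot) by rewrite cat_take_drop perm_sym perm_sort.
have sorted_tb : sorted >=%R (map (rho \o expand) (top ++ bot)).
  by rewrite cat_take_drop sorted_map sort_sorted.
have [F FP] := perm_cleaves_plug c; have [G GP] := perm_croot_degs_plug c.
have [le_I leaves_I degs_I] := better_ys.
have F_nil Xs Ys : perm_eq (Rs ++ Ls) (Xs ++ Ys) ->
    cleaves (CNode (cplug c (CNode Ys) :: Xs)) = [::].
  move=> /(perm_cleaves_exchange c); rewrite -(permPl leaves_I) leavesE.
  by rewrite perm_sym => /perm_nilP.
have a_gt0 : 0 < a by apply: leq_trans le_ba; apply: ltnW.
have b2E : b.-2.+1 = b.-1 by case: (b) b_ge2 => [|[]].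
have degsP Xs Ys : perm_eq (Rs ++ Ls) (Xs ++ Ys) ->
    perm_eq [:: size Xs; size Ys] [:: a; b.-2] ->
    perm_eq (root_degs (expand (CNode (cplug c (CNode Ys) :: Xs)))) (a.+1 :: b.-1 :: D).
  move=> perm_XY size_XY; rewrite (permPl (root_degs_expand _)) F_nil // cats0.
  rewrite (permPl (GP _ _)).
  have sizes : perm_eq (map S [:: size Xs; size Ys]) [:: a.+1; b.-1].
    by have := perm_map S size_XY; rewrite [map _ [:: a; _]]/= b2E.
  rewrite -[a.+1 :: _]/([:: a.+1; b.-1] ++ D) perm_cat // {sizes}.
  have : perm_eq (croot_degs (CNode (cplug c (CNode Ls) :: Rs))) ([:: a; b] ++ D).
    by rewrite -(permPl degs_I) degsE.
  rewrite (permPl (GP Rs Ls)) [map _ _]/= size_Rs size_Ls (prednK a_gt0) perm_cat2l.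
  move=> perm_D; rewrite -(permPr perm_D) perm_cat2l.
  by rewrite perm_flatten // perm_map // perm_sym.
have [|le_J|le_J] := cexchange I_inv I_compat c perm_tb sorted_tb.
- by rewrite size_bot size_Rs size_top; lia.
- exists (expand (CNode (cplug c (CNode bot) :: top))); split.
    by rewrite -expE; apply: le_trans le_J.
  by apply: degsP => //; rewrite size_top size_bot.
exists (expand (CNode (cplug c (CNode top) :: bot))); split.
  by rewrite -expE; apply: le_trans le_J.
by apply: degsP; [rewrite (permPl perm_tb) perm_catC|rewrite size_top size_bot perm_cons2].
Qed.

Lemma sumn_sqr_le (s : seq nat) : sumn [seq x * x | x <- s] <= sumn s * sumn s.
Proof. by elim: s => //= x s; nia. Qed.

(** Each transfer increases the sum of squares, which is bounded by the square of the fixed sum. *)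
Lemma reach_degrees B D t : all (ltn 0) B -> all (ltn 0) D -> size D = size B ->
  sumn D = sumn B -> (forall c, excess D c <= excess B c) ->
  perm_eq (root_degs t) D ->
  exists u, (I (unroot t) <= I (unroot u))%R /\ perm_eq (root_degs u) B.
Proof.
move=> B_gt0; have [n] := ubnP (sumn B * sumn B - sumn [seq x * x | x <- D]).
elim: n D t => // n IH D t le_n D_gt0 size_D sum_D le_ex degs_t.
have count_gt0 s : all (ltn 0) s -> count (ltn 0) s = size s.
  by rewrite all_count => /eqP.
have ex1 : excess D 1 = excess B 1.
  have := excessS D 0; rewrite (count_gt0 D D_gt0) excess0 sum_D size_D.
  by rewrite -excess0 (excessS B 0) (count_gt0 B B_gt0) => /addIn.
have ex0 : excess D 0 = excess B 0 by rewrite !excess0.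
have [eq_ex|[a [b [D' [perm_D b_a lt_ex]]]]] := excess_window le_ex ex0 ex1.
  by exists t; split=> //; apply: perm_trans degs_t (excess_perm B_gt0 D_gt0 eq_ex).
have [u [le_u degs_u]] := transfer_degree (perm_trans degs_t perm_D) b_a.
have sumD' := perm_sumn perm_D; have sizeD' := perm_size perm_D.
rewrite /= in sumD' sizeD'.
have [||||||v [le_v degs_v]] := IH (a.+1 :: b.-1 :: D') u.
- have := perm_sumn (perm_map (fun x => x * x) perm_D).
  have := sumn_sqr_le (a.+1 :: b.-1 :: D').
  rewrite /= => le_sq eq_sq; move: le_n; rewrite eq_sq => le_n.
  have sumE : a.+1 + (b.-1 + sumn D') = sumn B by lia.
  rewrite sumE in le_sq.
  have gain : a * a + (b * b) < a.+1 * a.+1 + b.-1 * b.-1 by case: (b) b_a => // b'; nia.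
  by move: (a * a) (b * b) (a.+1 * a.+1) (b.-1 * b.-1) (sumn (map _ D')) (sumn B * sumn B)
    gain le_sq le_n => *; lia.
- have : all (ltn 0) (a :: b :: D') by rewrite -(perm_all _ perm_D).
  by move=> /= /and3P[_ _ ->]; rewrite andbT; lia.
- by rewrite /=; lia.
- by rewrite /=; lia.
(* The transfer raises the excess by one exactly for [b <= c <= a], where it was too small. *)
- move=> c; have := le_ex c; have := lt_ex c; rewrite (perm_excess c perm_D).
  by rewrite /excess /=; lia.
- exact: degs_u.
by exists v; split=> //; apply: le_trans le_v.
Qed.

End Transfer.

Lemma root_degs_gt0 t : 1 < size (root_degs t) -> all (ltn 0) (root_degs t).
Proof.
have [_ _] := uncontractedP t; case: (uncontracted t) => [? ? <- //|xs <-].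
by move=> /croot_degs_gt0 gt0; apply/allP.
Qed.

Lemma root_degs_singleton t : size (root_degs t) = 1 -> root_degs t = [:: 0].
Proof.
case: t => -[|t ts] //; rewrite /root_degs /= size_cat => -[].
by case: t.
Qed.

(** * The maximum over all majorised degree sequences *)

Section Optimality.
Context {R : realType} (rho : rtree -> R) (I : tree -> R).
Hypothesis I_inv : tree_invariant I.
Hypothesis I_compat : max_compatible rho I.

(** Only trees with degrees exactly [B] have to be compared with [m]. That [m] has these degrees
    itself follows by comparing it with a tree realising [B]. *)
Lemma max_of_better B (M : tree) (m : rtree) : isomorphic (unroot m) M ->
  (exists T, degree_seq T = B) ->
  (forall t, perm_eq (root_degs t) B -> better I t m) ->
  is_max (values_on (majorised_trees B) I) (I M).
Proof.
move=> iso_m [T0 T0_B] better_m.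
have sorted_deg T : sorted geq (degree_seq T) by apply: sort_sorted geq_total _.
have degs_perm t T : isomorphic (unroot t) T -> perm_eq (root_degs t) (degree_seq T).
  by move=> /isomorphic_degree_seq <-; rewrite degree_seq_unroot perm_sym perm_sort.
have [t0 iso_t0] := tree_unroot T0.
have degs_t0 : perm_eq (root_degs t0) B by rewrite -T0_B degs_perm.
rewrite -(I_inv iso_m); split.
  have degs_mB : degree_seq (unroot m) = B.
    have [_ degs_m] := better_m t0 degs_t0.
    rewrite degree_seq_unroot -T0_B -[RHS](sorted_sort geq_trans (sorted_deg _)).
    apply/(perm_sortP geq_total geq_trans geq_anti).
    by rewrite -(permPl degs_m) degs_perm.
  by exists (unroot m) => //; rewrite /majorised_trees degs_mB; split.
move=> _ [T maj_T <-]; have [t iso_t] := tree_unroot T; rewrite -(I_inv iso_t).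
have degs_t := degs_perm _ _ iso_t; set D := degree_seq T in maj_T degs_t.
suff [u [le_u degs_u]] : exists u, (I (unroot t) <= I (unroot u))%R /\
    perm_eq (root_degs u) B.
  by apply: le_trans le_u _; have [] := better_m u degs_u.
have [size_BD sum_BD _] := maj_T.
have [D_gt1|D_le1] := ltnP 1 (size D).
  apply: (reach_degrees I_inv I_compat _ _ _ _ _ degs_t) => //.
  - rewrite -(perm_all _ degs_t0); apply: root_degs_gt0.
    by rewrite (perm_size degs_t0) size_BD.
  - rewrite -(perm_all _ degs_t); apply: root_degs_gt0.
    by rewrite (perm_size degs_t).
  - by apply: majorises_excess maj_T; apply: sorted_deg.
(* The tree with one vertex has degree 0 and so escapes the argument for positive degrees. *)
have single v E : perm_eq (root_degs v) E -> size E <= 1 -> root_degs v = [:: 0].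
  move=> /perm_size size_v E_le1; apply: root_degs_singleton; apply/eqP.
  by rewrite eqn_leq size_v E_le1 -size_v.
exists t; split=> //.
rewrite (single _ _ degs_t) // -(single _ _ degs_t0) //.
by rewrite size_BD.
Qed.

End Optimality.

Local Open Scope ring_scope.
Local Open Scope classical_set_scope.

Theorem theorem4p1 (R : realType) (rho : rtree -> R) (f_rho : seq R -> R)
    (I : tree -> R) (B : seq nat)
    (f_rho_sym : symmetric_on rho f_rho)
    (rhoE : forall ts : seq rtree, rho (Node ts) = f_rho [seq rho t | t <- ts])
    (I_inv : tree_invariant I)
    (I_compat : max_compatible rho I)
    (B_tree : exists T : tree, degree_seq T = B) :
  (strictly_increasing_on rho f_rho ->
   (forall S : rtree, (1 < #|vertex (unroot S)|)%N -> rho bullet < rho S) ->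
   is_max (values_on (majorised_trees B) I) (I (greedy_tree B))) /\
  (strictly_decreasing_on rho f_rho ->
   (forall S : rtree, (1 < #|vertex (unroot S)|)%N -> rho S < rho bullet) ->
   is_max (values_on (majorised_trees B) I) (I (Mtree B))).

Proof.
have [T0 T0_B] := B_tree.
have sorted_B : sorted geq B by rewrite -T0_B; apply: sort_sorted geq_total _.
have [t0 iso_t0] := tree_unroot T0.
have degs_t0 : perm_eq (root_degs t0) B.
  by rewrite -T0_B -(isomorphic_degree_seq iso_t0) degree_seq_unroot perm_sym perm_sort.
have B_cons : B = head 0%N B :: behead B.
  by have := perm_size degs_t0; case: (B).
have uncontract t : perm_eq (root_degs t) B -> exists xs,
    [/\ expand (CNode xs) = t, cleaves (CNode xs) = [::] &
        perm_eq (croot_degs (CNode xs)) B].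
  have [expE leavesE degsE] := uncontractedP t.
  case: (uncontracted t) expE leavesE degsE => [? ? //|xs] expE leavesE degsE degs_t.
  by exists xs; rewrite degsE.
split=> [[f_mono f_app] _|[f_mono f_app] _].
- have rho_mono := node_monotone rhoE (@lexx _ _) (@le_trans _ _)
    (fun xs x y ys vx vy lt_xy => ltW (f_mono xs x y ys vx vy lt_xy))
    (fun xs ys v ys_n0 => ltW (f_app xs ys v ys_n0)).
  have inv0 : huffman_inv rho [::] B [::] by split.
  have greedyP t : perm_eq (root_degs t) B ->
      [/\ better I t (Node (foldr huffman_step [::] (behead B))),
        huffman_fits [::] (behead B) &
        size (foldr huffman_step [::] (behead B)) = head 0%N B].
    move=> /uncontract[xs [<- leaves_xs degs_xs]].
    apply: (better_huffman I_inv I_compat rho_mono inv0 sorted_B _ degs_xs).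
    by rewrite leaves_xs.
  have greedyE : greedy_tree B = unroot (Node (foldr huffman_step [::] (behead B))).
    have [_ fits sizeB] := greedyP t0 degs_t0.
    by rewrite {1}B_cons; apply: greedy_tree_huffman.
  apply: (max_of_better I_inv I_compat (m := Node (foldr huffman_step [::] (behead B)))).
  + by rewrite greedyE; exists id => //; exists id.
  + exact: B_tree.
  by move=> t /greedyP[].
have rho_mono : forall Xs Ys, (size Xs <= size Ys)%N ->
    {in Xs & Ys, forall S T, rho S <= rho T} -> rho (Node Ys) <= rho (Node Xs).
  apply: (node_monotone (le := fun x y => y <= x) rhoE).
  + exact: lexx.
  + by move=> y x z /[swap]; apply: le_trans.
  + by move=> xs x y ys vx vy lt_xy; apply/ltW/f_mono.
  + by move=> xs ys v ys_n0; apply/ltW/f_app.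
have B_gt0 : (1 < size B)%N -> all (ltn 0) B.
  by move=> B_gt1; rewrite -(perm_all _ degs_t0) root_degs_gt0 // (perm_size degs_t0).
have sorted_ds : sorted geq (reduced B) by apply: (sorted_filter geq_trans).
have ds_ge2 : all (leq 2) (reduced B) by apply: filter_all.
have reduce t ds k : perm_eq (root_degs t) B -> ds <> [::] -> perm_eq B (ds ++ nseq k 1%N) ->
    exists ys, [/\ better I t (expand (CNode ys)),
      perm_eq (map snd (cleaves (CNode ys))) (nseq k bullet) &
      perm_eq (croot_degs (CNode ys)) ds].
  move=> /uncontract[xs [<- leaves_xs degs_xs]] ds_n0 perm_B.
  have [|ys] := better_collapse_leaves I_inv I_compat (j := 0) ds_n0 _
                  (perm_trans degs_xs perm_B).
    by rewrite leaves_xs.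
  by rewrite addn0 => ysP; exists ys.
have [m mE better_m] : exists2 m, Mtree B = unroot m &
    forall t, perm_eq (root_degs t) B -> better I t m.
  have [ds0|ds_n0] := eqVneq (reduced B) [::].
    exists (Node (nseq (size B).-1 bullet)); first by rewrite /Mtree ds0.
    (* With no degree above 1, the first degree is kept for the root and all others are 1. *)
    have perm_B : perm_eq B ([:: head 0%N B] ++ nseq (size B).-1 1%N).
      rewrite {1}B_cons /= perm_cons -size_behead.
      suff /all_pred1P <- : all (pred1 1%N) (behead B) by [].
      apply/allP => e e_in; have e_inB := mem_behead e_in.
      have e_gt0 : (0 < e)%N.
        apply: (allP (B_gt0 _)) e_inB; move: e_in; rewrite {2}B_cons /= ltnS lt0n size_eq0.
        by case: (behead B).
      have : e \notin reduced B by rewrite ds0.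
      by rewrite mem_filter e_inB andbT -ltnNge /= eqn_leq e_gt0 andbT.
    move=> t degs_t; have [//|ys [better_ys leaves_ys degs_ys]] := reduce t _ _ degs_t _ perm_B.
    apply: better_trans better_ys _; apply: isomorphic_better => //.
    by apply: unroot_perm; rewrite expand_leaves // (perm_size degs_ys).
  have [e [e_in e_ge2]] : exists e, e \in B /\ (2 <= e)%N.
    case E: (reduced B) ds_n0 => [//|e s] _; exists e; apply/andP.
    by rewrite andbC -mem_filter -/(reduced B) E mem_head.
  have all_gt0 : all (ltn 0) B.
    apply: B_gt0; rewrite ltnNge; apply/negP => B_le1.
    have size_t0 : size (root_degs t0) = 1%N.
      apply/eqP; rewrite eqn_leq (perm_size degs_t0) B_le1.
      by case: (B) e_in.
    move: e_in e_ge2; rewrite -(perm_mem degs_t0) (root_degs_singleton size_t0).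
    by rewrite inE => /eqP->.
  pose k := count (predC (leq 2)) B.
  have perm_B : perm_eq B (reduced B ++ nseq k 1%N).
    rewrite (_ : nseq k 1%N = filter (predC (leq 2)) B).
      by rewrite perm_sym perm_filterC.
    rewrite /k -size_filter; apply/esym/all_pred1P/allP => x.
    rewrite mem_filter => /andP[/= x_lt2 x_in].
    have x_gt0 : (0 < x)%N := allP all_gt0 x x_in.
    by rewrite eqn_leq x_gt0 andbT -ltnS ltnNge.
  have ds_n0' : reduced B <> [::] by apply/eqP.
  have reduceB t degs_t := reduce t _ _ degs_t ds_n0' perm_B.
  exists (mcontract (size (reduced B)) (reduced B) (nseq k bullet)).
    have [ys [_ leaves_ys degs_ys]] := reduceB t0 degs_t0.
    apply: Mtree_mcontract => //.
    have := sumn_croot_degs ys; rewrite (perm_sumn degs_ys) (perm_size degs_ys) => ->.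
    by rewrite -(size_map snd) (perm_size leaves_ys) size_nseq.
  move=> t degs_t; have [ys [better_ys leaves_ys degs_ys]] := reduceB t degs_t.
  apply: better_trans better_ys _.
  apply: (better_mcontract I_inv I_compat rho_mono _ _ _ _ leaves_ys degs_ys) => //.
  exact: contraction_inv_bullets.
apply: (max_of_better I_inv I_compat (m := m)) => //.
by rewrite mE; exists id => //; exists id.
Qed.
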